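(* Let $(X,\tau,d)$ be an extended metric-topological space and let $\mathsf{HK}$ be the Hellinger-Kantorovich functional on $\mathcal M(X)\times\mathcal M(X)$ defined in the context. Then $\mathsf{HK}$ is a distance on $\mathcal M(X)$; in particular, for every $\mu_1,\mu_2,\mu_3\in\mathcal M(X)$, $$\mathsf{HK}(\mu_1,\mu_3)\le\mathsf{HK}(\mu_1,\mu_2)+\mathsf{HK}(\mu_2,\mu_3).$$
   Context: An extended metric-topological space $(X,\tau,d)$ is a Hausdorff topological space $(X,\tau)$ with an extended distance $d:X\times X\to[0,\infty]$ that is lower semicontinuous w.r.t. $\tau$. $\mathcal M(X)$ is the set of finite nonnegative Radon measures on $X$. Cone: $\mathfrak C$ is the quotient of $X\times[0,\infty)$ obtained by identifying all points $(x,0)$ with a single point $\mathfrak o$ (the vertex); classes are $[x,r]$. With $d_\pi=\min(d,\pi)$, $d_{\mathfrak C}^2([x_1,r_1],[x_2,r_2])=r_1^2+r_2^2-2r_1r_2\cos(d_\pi(x_1,x_2))$. Topology of $\mathfrak C$: neighborhoods of points of $\mathfrak C\setminus\{\mathfrak o\}$ are those of $X\times(0,\infty)$, and the sets $\{[x,r]:0\le r<\varepsilon\}$, $\varepsilon>0$, are a basis of neighborhoods of $\mathfrak o$. Put $\mathsf r([x,r])=r$ and $\mathsf x([x,r])=x$ if $r>0$, $\mathsf x(\mathfrak o)=\bar x$ for a fixed arbitrary $\bar x\in X$. On $\mathfrak C\times\mathfrak C$ let $\mathsf x_i,\mathsf r_i$ be $\mathsf x,\mathsf r$ evaluated at the $i$-th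 component. For a Radon measure $\alpha\in\mathcal M(\mathfrak C\times\mathfrak C)$ with $\int(\mathsf r_1^2+\mathsf r_2^2)\,d\alpha<\infty$ (we write $\alpha\in\mathcal M_2(\mathfrak C\times\mathfrak C)$), the homogeneous marginals are $\mathfrak h_i\alpha=(\mathsf x_i)_\sharp(\mathsf r_i^2\alpha)\in\mathcal M(X)$ (independent of $\bar x$). Then $$\mathsf{HK}^2(\mu_1,\mu_2)=\min\Big\{\int d_{\mathfrak C}^2\,d\alpha:\ \alpha\in\mathcal M_2(\mathfrak C\times\mathfrak C),\ \mathfrak h_i\alpha=\mu_i,\ i=1,2\Big\},\qquad \mathsf{HK}\ge 0.$$ *)

(* Defs.v *)
From HB Require Import structures.
From mathcomp Require Import all_boot all_order all_algebra generic_quotient.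
From mathcomp Require Import interval_inference.
From mathcomp Require Import all_classical all_reals all_analysis.

Set Implicit Arguments.
Unset Strict Implicit.
Unset Printing Implicit Defensive.

Import Order.TTheory GRing.Theory Num.Theory.
Import numFieldNormedType.Exports.

Local Open Scope classical_set_scope.
Local Open Scope ring_scope.
Local Open Scope quotient_scope.

(* The relation [E] plays the role of equality on [T]. *)
Record is_extended_distance (R : realType) (T : Type) (E : T -> T -> Prop)
    (d : T -> T -> \bar R) : Prop := IsExtendedDistance {
  edist_ge0 : forall x y, (0 <= d x y)%E ;
  edist_eq0 : forall x y, d x y = 0%E <-> E x y ;
  edist_sym : forall x y, d x y = d y x ;
  edist_triangle : forall x y z, (d x z <= d x y + d y z)%E
}.

Record is_distance (R : realType) (T : Type) (E : T -> T -> Prop)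
    (d : T -> T -> \bar R) : Prop := IsDistance {
  dist_extended : is_extended_distance E d ;
  dist_fin_num : forall x y, d x y \is a fin_num
}.

Record is_extended_metric_topological (R : realType) (X : topologicalType)
    (d : X -> X -> \bar R) : Prop := IsExtendedMetricTopological {
  emt_hausdorff : hausdorff_space X ;
  emt_distance : is_extended_distance eq d ;
  emt_lsc : lower_semicontinuous (fun p : X * X => d p.1 p.2)
}.

HB.instance Definition _ (T U : ptopologicalType) :=
  Topological.on (T * U)%type.

(* T with its Borel sigma-algebra.  For a product of topological spaces this is
   the Borel sigma-algebra of the product topology, which may be larger than
   the product of the Borel sigma-algebras. *)
Notation borel T := (g_sigma_algebraType (@open T)).

Definition is_radon (R : realType) (T : ptopologicalType)
    (mu : set (borel T) -> \bar R) : Prop :=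
  forall B : set (borel T), measurable B -> forall e : R, 0 < e ->
    exists K : set T,
      [/\ compact K, K `<=` B & (mu (B `\` K) <= e%:E)%E].

Record radon_measure (R : realType) (T : ptopologicalType) := RadonMeasure {
  radon_val :> {finite_measure set (borel T) -> \bar R} ;
  radonP : is_radon radon_val
}.

(* Library measures are functions on all subsets, but only their values on
   measurable sets are meaningful. *)
Definition eq_radon (R : realType) (T : ptopologicalType)
    (mu nu : radon_measure R T) : Prop :=
  forall B : set (borel T), measurable B -> mu B = nu B.

Section cone.
Context (R : realType) (X : ptopologicalType).

Definition cone_rel (p q : X * {nonneg R}) : bool :=
  (p == q) || (p.2%:num == 0) && (q.2%:num == 0).

Lemma cone_rel_refl : reflexive cone_rel.
Proof. by move=> p; rewrite /cone_rel eqxx. Qed.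

Lemma cone_rel_sym : symmetric cone_rel.
Proof. by move=> p q; rewrite /cone_rel eq_sym andbC. Qed.

Lemma cone_rel_trans : transitive cone_rel.
Proof.
move=> q p s; rewrite /cone_rel => /orP[/eqP->//|/andP[p0 q0]].
by case/orP=> [/eqP<-|/andP[_ s0]]; rewrite p0 ?q0 ?s0 orbT.
Qed.

Definition cone_equiv : equiv_rel (X * {nonneg R}) :=
  EquivRel cone_rel cone_rel_refl cone_rel_sym cone_rel_trans.

Definition cone : Type := {eq_quot cone_equiv}.

HB.instance Definition _ := Choice.copy cone {eq_quot cone_equiv}.
HB.instance Definition _ := Quotient.copy cone {eq_quot cone_equiv}.

(* [x, r] *)
Definition cone_pt (x : X) (r : {nonneg R}) : cone := \pi_cone (x, r).

Definition vertex : cone := cone_pt point 0%:nng.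

HB.instance Definition _ := isPointed.Build cone vertex.

Definition cone_radius (c : cone) : R := (repr c).2%:num.

Definition cone_base (xbar : X) (c : cone) : X :=
  if 0 < cone_radius c then (repr c).1 else xbar.

Lemma cone_relE (x : X) (r : {nonneg R}) :
  cone_rel (repr (cone_pt x r)) (x, r).
Proof. by have /eqmodP := reprK (cone_pt x r). Qed.

Lemma cone_radius_pt (x : X) (r : {nonneg R}) :
  cone_radius (cone_pt x r) = r%:num.
Proof.
rewrite /cone_radius.
by have /orP[/eqP->//|/andP[/eqP-> /eqP/= ->]] := cone_relE x r.
Qed.

Lemma cone_base_pt (xbar x : X) (r : {nonneg R}) : 0 < r%:num ->
  cone_base xbar (cone_pt x r) = x.
Proof.
move=> r0; rewrite /cone_base cone_radius_pt r0.
have /orP[/eqP->//|/andP[_ /= /eqP rE]] := cone_relE x r.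
by rewrite rE ltxx in r0.
Qed.

Lemma cone_ptE (c : cone) : cone_pt (repr c).1 (repr c).2 = c.
Proof. by rewrite /cone_pt -surjective_pairing reprK. Qed.

(* Away from the vertex, a neighborhood of [x, r] is a set whose preimage under
   [., .] is a neighborhood of (x, r) in X * R; since r > 0, whether one uses
   R or its open subset of positive numbers is immaterial. *)
Definition cone_nbhs (c : cone) : set_system cone :=
  if 0 < cone_radius c then
    [set A | nbhs ((repr c).1, cone_radius c) [set q : X * R |
       forall r : {nonneg R}, r%:num = q.2 -> A (cone_pt q.1 r)]]
  else [set A | exists2 e : R, 0 < e & [set c' | cone_radius c' < e] `<=` A].

HB.instance Definition _ := hasNbhs.Build cone cone_nbhs.

Lemma cone_nbhs_filter (c : cone) : ProperFilter (nbhs c).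
Proof.
rewrite /nbhs/= /cone_nbhs; case: ifPn => [r0|r0].
  apply: Build_ProperFilter_ex => [A /nbhs_singleton/= /(_ (repr c).2 erefl)|].
    by exists (cone_pt (repr c).1 (repr c).2).
  have FF : Filter (nbhs ((repr c).1, cone_radius c)) by exact: nbhs_filter.
  split=> [|A B hA hB|A B AB hA].
  - exact: (@filterS _ _ FF setT _ _ filterT).
  - by apply: (@filterS2 _ _ FF _ _ _ _ hA hB) => q {}hA {}hB r rq;
      split; [exact: hA|exact: hB].
  - by apply: (@filterS _ _ FF _ _ _ hA) => q {}hA r rq; apply: AB; exact: hA.
have rc0 : cone_radius c = 0.
  by apply/eqP; rewrite eq_le leNgt r0 /= /cone_radius.
apply: Build_ProperFilter_ex => [A [e e0 eA]|].
  by exists c; apply: eA => /=; rewrite rc0.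
split=> [|A B [e e0 eA] [f f0 fB]|A B AB [e e0 eA]] /=.
- by exists 1.
- exists (Num.min e f); first by rewrite lt_min e0.
  by move=> c' /=; rewrite lt_min => /andP[/eA ? /fB].
- by exists e => // c' /eA/AB.
Qed.

Lemma cone_nbhs_singleton (c : cone) (A : set cone) : nbhs c A -> A c.
Proof.
rewrite /nbhs/= /cone_nbhs; case: ifPn => [r0|r0].
  by move=> /nbhs_singleton/= /(_ (repr c).2 erefl); rewrite cone_ptE.
move=> [e e0]; apply => /=; rewrite (le_lt_trans _ e0)//.
by rewrite leNgt.
Qed.

Lemma cone_nbhs_nbhs (c : cone) (A : set cone) :
  nbhs c A -> nbhs c (nbhs^~ A).
Proof.
have key (x : X) (r : {nonneg R}) (B : set cone) : 0 < r%:num ->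
    nbhs (x, r%:num) [set q : X * R |
       forall r : {nonneg R}, r%:num = q.2 -> B (cone_pt q.1 r)] ->
    nbhs (cone_pt x r) B.
  move=> r0 hB; rewrite /nbhs/= /cone_nbhs cone_radius_pt r0.
  suff -> : (repr (cone_pt x r)).1 = x by [].
  by have := cone_base_pt point x r0; rewrite /cone_base cone_radius_pt r0.
have pos (x : X) (s : R) : 0 < s -> nbhs (x, s) [set q : X * R | 0 < q.2].
  move=> s0; exists (setT, [set t | 0 < t]) => /=; last by case=> ? ? [].
  by split; [exact: filterT|exact: lt_nbhsr].
rewrite {1 2}/nbhs/= /cone_nbhs; case: ifPn => [r0|r0].
  set V := fun A : set cone => [set q : X * R | forall r : {nonneg R},
    r%:num = q.2 -> A (cone_pt q.1 r)].
  move=> hV; have {}hV : nbhs ((repr c).1, cone_radius c) (interior (V A)) :=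
    nbhs_interior hV.
  apply: (@filterS2 _ _ (nbhs_filter _) _ _ _ _ hV (pos _ _ r0)).
  move=> [x s] /= hq s0 r rs; apply: key; first by rewrite rs.
  by rewrite rs.
move=> [e e0 eA]; exists e => // c' /= c'e.
have [c'0|c'0] := ltP 0 (cone_radius c'); last first.
  by rewrite /nbhs/= /cone_nbhs ltNge c'0/=; exists e.
rewrite -(cone_ptE c'); apply: key => //.
exists (setT, [set t | t < e]) => /=.
  by split; [exact: filterT|exact: lt_nbhsl].
by case=> y t [_ /= te] s st; apply: eA => /=; rewrite cone_radius_pt st.
Qed.

HB.instance Definition _ := Nbhs_isNbhsTopological.Build cone
  cone_nbhs_filter cone_nbhs_singleton cone_nbhs_nbhs.

End cone.

Section hellinger_kantorovich.
Context (R : realType) (X : ptopologicalType).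
Local Notation C := (cone R X).

(* The base points are only relevant when both radii are positive, so the
   choice of the representatives is immaterial. *)
Definition cone_dist2 (d : X -> X -> \bar R) (c1 c2 : C) : R :=
  let r1 := cone_radius c1 in
  let r2 := cone_radius c2 in
  r1 ^+ 2 + r2 ^+ 2 - 2 * r1 * r2 *
    cos (fine (Order.min (d (repr c1).1 (repr c2).1) pi%:E)).

(* (x_i)_# (r_i^2 alpha), where [pr] is the i-th projection *)
Definition homogeneous_marginal (xbar : X) (pr : C * C -> C)
    (alpha : radon_measure R (C * C)%type) : set (borel X) -> \bar R :=
  pushforward
    (fun A : set (borel (C * C)%type) =>
       \int[alpha]_(p in A) (cone_radius (pr p) ^+ 2)%:E)%E
    (cone_base xbar \o pr : borel (C * C)%type -> borel X).

Definition HK_admissible (xbar : X) (mu1 mu2 : radon_measure R X) :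
    set (radon_measure R (C * C)%type) :=
  [set alpha : radon_measure R (C * C)%type |
    [/\ (\int[alpha]_p
          (cone_radius (p : C * C).1 ^+ 2 +
           cone_radius (p : C * C).2 ^+ 2)%:E < +oo)%E,
        forall B : set (borel X), measurable B ->
          homogeneous_marginal xbar fst alpha B = mu1 B
      & forall B : set (borel X), measurable B ->
          homogeneous_marginal xbar snd alpha B = mu2 B]].

Definition HK_cost (d : X -> X -> \bar R)
    (alpha : radon_measure R (C * C)%type) : \bar R :=
  (\int[alpha]_p (cone_dist2 d (p : C * C).1 (p : C * C).2)%:E)%E.

(* [sqrte] is nonnegative, and [ereal_inf] is the minimum when attained. *)
Definition HK (d : X -> X -> \bar R) (xbar : X) (mu1 mu2 : radon_measure R X) :
    \bar R :=
  sqrte (ereal_inf (HK_cost d @` HK_admissible xbar mu1 mu2)).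

End hellinger_kantorovich.

(* Main.v *)
Require Import Defs.
From HB Require Import structures.
From mathcomp Require Import all_boot all_order all_algebra finmap.
From mathcomp Require Import interval_inference.
From mathcomp Require Import all_classical all_reals all_analysis.
From mathcomp Require Import measurable_realfun ring lra.

Set Implicit Arguments.
Unset Strict Implicit.
Unset Printing Implicit Defensive.

Import Order.TTheory GRing.Theory Num.Theory.
Import numFieldNormedType.Exports.

Local Open Scope classical_set_scope.
Local Open Scope ring_scope.

(** Each axiom comes down to building or estimating plans on pairs of points of
    the cone.  Symmetry swaps the two components of a plan; the infimum is
    finite because mu1 may be sent to the vertex and mu2 created from it; and
    [eq_radon] measures have infimum zero through the plan carried by the
    diagonal, the image of mu1 under x |-> ([x, 1], [x, 1]).

    Nondegeneracy ([mass_le], [HK_inf0_le]).  Let K and K' be disjoint compact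
    sets.  By lower semicontinuity d is bounded below on K x K' by a positive
    number, so moving mass from K to K' costs a fixed proportion of that mass.
    Hence mu K is at most nu K, plus twice the nu-mass outside K and K', up to
    errors controlled by the cost.  If plans of arbitrarily small cost exist,
    letting K' exhaust the complement of K gives mu K <= nu K, then mu <= nu on
    Borel sets by inner regularity, and the two measures agree by symmetry.

    Triangle inequality ([glued_plan], [HK_inf_young], [sqrtr_young]).  Let
    alpha couple mu1 to mu2 and beta couple mu2 to mu3.  Marginals and cost are
    homogeneous of degree two in the radii, so where its middle radius is
    positive each plan can be rescaled to have middle radius 1; its homogeneous
    marginal on the middle factor then is its ordinary marginal on X, equal to
    mu2 ([normalized_measure]).  The two rescaled plans are glued along that
    marginal, and the parts with middle radius 0, which put no mass in mu2, are
    added back unchanged.  In place of the triangle inequality of the cone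
    distance, integrated by Minkowski's inequality, the proof integrates
        d13^2 <= (1 + eta) d12^2 + (1 + 1/eta) d23^2   for all eta > 0,
    which holds for three points of the cone because it holds in the plane
    ([planar_triangle], [cone_dist2_triangle]), and then optimizes over eta.

    Gluing ([glue]).  X is only a Hausdorff space, so disintegration of measures
    cannot be used.  For measures alpha on P and beta on Q with the same image
    in Y, each finite Borel partition of Y defines an explicit finitely additive
    coupling, namely the product measure conditioned on both points lying over
    the same cell.  A limit along an ultrafilter of ever finer partitions is
    still finitely additive with the right marginals, hence tight, and gives
    no mass to A x B when A and B lie over disjoint open sets of Y.
    Such a set function, known on enough open sets, induces a Radon measure
    ([radon_of_content]): this is the classical passage from a content on
    compact sets to a Radon measure.  Its marginals are the prescribed ones
    because they are dominated on open sets and have the right total mass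
    ([pushforward_radon_eq]). *)

(** * Compact sets in Hausdorff spaces, and Radon measures from contents *)

(** A point separated from F lies outside the closure of all small enough
    members of F, and so do its neighbors; compactness makes one member of F
    work for all of A.  Applied to the neighborhoods of a point, then to those
    of a compact set, this separates two compact sets. *)
Lemma filter_compact_disjoint (T : topologicalType) (A : set T)
    (F : set_system T) : ProperFilter F -> compact A ->
  (forall x, A x -> exists N W, [/\ nbhs x N, F W & N `&` W = set0]) ->
  exists O W, [/\ open O, A `<=` O, F W & O `&` W = set0].
Proof.
move=> FF /compact_near_coveringP cA sep.
have : \forall W \near powerset_filter_from F, A `<=` (fun x => ~ closure W x).
  apply: cA.
  move=> x /sep[N [W [xN FW NW]]].
  near=> x' W' => /= clW'.
  have Nx' : nbhs x' N by near: x'; exact: nbhs_interior.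
  have [y [W'y Ny]] := clW' N Nx'.
  have : (N `&` W) y.
    split=> //; move: y {Ny} W'y; change (W' `<=` W); near: W'.
    exact: small_set_sub.
  by rewrite NW.
move=> /near_powerset_filter_fromP[|W FW AW].
  by move=> V W VW WA x /WA + clV; apply; exact: closureS clV.
exists (~` closure W), W; split=> //.
- by apply: closed_openC; exact: closed_closure.
- by rewrite -subset0 => x [clW /subset_closure].
Unshelve. all: by end_near. Qed.

Lemma compact_separated (T : topologicalType) (A B : set T) :
  hausdorff_space T -> compact A -> compact B -> A `&` B = set0 ->
  exists O O', [/\ open O, open O', A `<=` O, B `<=` O' & O `&` O' = set0].
Proof.
move=> hT cA cB AB.
have [->|/set0P B0] := eqVneq B set0.
  exists setT, set0; split => //; [exact: openT|exact: open0|exact: setI0].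
have PB : ProperFilter (set_nbhs B) by exact: set_nbhs_pfilter.
have [|O [W [oO AO WB OW]]] := @filter_compact_disjoint _ A (set_nbhs B) _ cA.
  move=> x Ax.
  have [|O [W [oO BO xW OW]]] := @filter_compact_disjoint _ B (nbhs x) _ cB.
    move=> y By; have xy : y != x.
      apply/eqP => yx; have : (A `&` B) x by split => //; rewrite -yx.
      by rewrite AB.
    move: hT; rewrite open_hausdorff => /(_ _ _ xy)[[P Q] /=].
    rewrite !inE => -[yP xQ] [oP oQ /eqP PQ].
    by exists P, Q; split; [exact: open_nbhs_nbhs|exact: open_nbhs_nbhs|exact/eqP].
  exists W, O; split => //; last by rewrite setIC.
  by apply/set_nbhsP; exists O; split => //; exact: subset_refl.
move: WB => /set_nbhsP[C [oC BC CW]].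
exists O, C; split => //.
by rewrite -subset0 -OW => x [Ox /CW].
Qed.

(** The family U is only assumed to contain small neighborhoods of compact sets
    and to be stable under union: for a limit of product measures, only open
    sets that are also measurable for the product sigma-algebra have a value
    under L. *)
Section content.
Context {R : realType} {T : ptopologicalType} (hT : hausdorff_space T).
Variables (U : set (set T)) (L : set T -> R) (M : R).
Hypothesis U_open : forall A, U A -> open A.
Hypothesis U_union : forall A B, U A -> U B -> U (A `|` B).
Hypothesis U_nbhs : forall K O, compact K -> open O -> K `<=` O ->
  exists V, [/\ U V, K `<=` V & V `<=` O].
Hypothesis L_ge0 : forall A, U A -> 0 <= L A.
Hypothesis L_le : forall A, U A -> L A <= M.
Hypothesis L_mono : forall A B, U A -> U B -> A `<=` B -> L A <= L B.
Hypothesis L_subadd : forall A B, U A -> U B -> L (A `|` B) <= L A + L B.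
Hypothesis L_add : forall A B, U A -> U B -> A `&` B = set0 ->
  L A + L B <= L (A `|` B).
Hypothesis L_tight : forall e : R, 0 < e -> exists2 K, compact K &
  forall V, U V -> K `<=` V -> M - e <= L V.

(* the content of a compact set: its measure, as will be seen in nuK *)
Let kap K : R := inf [set L V | V in [set V | U V /\ K `<=` V]].

Let kap_lb K : lbound [set L V | V in [set V | U V /\ K `<=` V]] 0.
Proof. by move=> _ [V [UV _] <-]; exact: L_ge0. Qed.

Let kap_n0 K : compact K -> [set L V | V in [set V | U V /\ K `<=` V]] !=set0.
Proof.
move=> cK; have [V [UV KV _]] := U_nbhs cK openT (@subsetT _ K).
by exists (L V), V.
Qed.

Let kap_le K V : U V -> K `<=` V -> kap K <= L V.
Proof.
by move=> UV KV; apply: ge_inf; [exists 0; exact: kap_lb | exists V].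
Qed.

Let kap_ge K x : compact K -> (forall V, U V -> K `<=` V -> x <= L V) ->
  x <= kap K.
Proof.
move=> cK h; apply: lb_le_inf; first exact: kap_n0.
by move=> _ [V [UV KV] <-]; exact: h.
Qed.

Let kap_ge0 K : compact K -> 0 <= kap K.
Proof. by move=> cK; apply: kap_ge => // V UV _; exact: L_ge0. Qed.

Let kap_approx K O e : compact K -> open O -> K `<=` O -> 0 < e ->
  exists V, [/\ U V, K `<=` V, V `<=` O & L V < kap K + e].
Proof.
move=> cK oO KO e0.
have [_ [V [UV KV] <-] lV] := @inf_adherent _ _ e e0
  (conj (kap_n0 cK) (ex_intro _ 0 (@kap_lb K))).
have [V' [UV' KV' V'O]] := @U_nbhs K (V `&` O) cK
  (openI (U_open UV) oO) (fun x Kx => conj (KV x Kx) (KO x Kx)).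
exists V'; split => //; first by move=> x /V'O[].
by apply: le_lt_trans lV; apply: L_mono => // x /V'O[].
Qed.

Let kap_mono K K' : compact K -> compact K' -> K `<=` K' -> kap K <= kap K'.
Proof.
move=> cK cK' KK'; apply: kap_ge => // V UV K'V; apply: kap_le => //.
exact: subset_trans K'V.
Qed.

Let kap_leM K : compact K -> kap K <= M.
Proof.
move=> cK; have [V [UV KV _]] := U_nbhs cK openT (@subsetT _ K).
exact: le_trans (kap_le UV KV) (L_le UV).
Qed.

Let kap0 : kap set0 = 0.
Proof.
apply/eqP; rewrite eq_le kap_ge0 ?andbT; last exact: compact0.
have [V [UV _ V0]] := U_nbhs (@compact0 T) open0 (@subset_refl _ set0).
have V0' : V = set0 by rewrite -subset0.
have := L_add UV UV; rewrite V0' setI0 setU0 => /(_ erefl).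
have := kap_le UV (@sub0set _ V); rewrite V0' => le0.
move=> ?; lra.
Qed.

Let kap_disj K K' : compact K -> compact K' -> K `&` K' = set0 ->
  kap K + kap K' <= kap (K `|` K').
Proof.
move=> cK cK' KK'; apply: kap_ge => [|V UV]; first exact: compactU.
rewrite subUset => -[KV K'V].
have [Q [P [oQ oP KQ KP QP]]] := compact_separated hT cK cK' KK'.
have [A [UA KA AO]] := @U_nbhs K (V `&` Q) cK
  (openI (U_open UV) oQ) (fun x Kx => conj (KV x Kx) (KQ x Kx)).
have [B [UB KB BO]] := @U_nbhs K' (V `&` P) cK'
  (openI (U_open UV) oP) (fun x Kx => conj (K'V x Kx) (KP x Kx)).
apply: (@le_trans _ _ (L A + L B)); first by apply: lerD; exact: kap_le.
apply: (@le_trans _ _ (L (A `|` B))).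
  by apply: L_add => //; rewrite -subset0 -QP => x [/AO[_ ?] /BO[_ ?]].
by apply: L_mono => //; [exact: U_union|move=> x [/AO[]|/BO[]]].
Qed.

Let kap_diff K K' e : compact K -> compact K' -> K `<=` K' -> 0 < e ->
  exists D, [/\ compact D, D `<=` K' `\` K & kap K' <= kap K + kap D + e].
Proof.
move=> cK cK' KK' e0.
have [V [UV KV _ lV]] := kap_approx cK openT (@subsetT _ K) e0.
have cD : compact (K' `\` V).
  by rewrite setDE; apply: compact_closedI => //; exact/open_closedC/U_open.
exists (K' `\` V); split => //; first by move=> x [? nV]; split => // /KV.
rewrite -lerBlDr -lerBlDl; apply: kap_ge => // W UW DW.
have : kap K' <= L (V `|` W).
  apply: kap_le; first exact: U_union.
  by move=> x K'x; have [?|?] := pselect (V x); [left|right; exact: DW].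
move=> /le_trans/(_ (L_subadd UV UW)) ?; lra.
Qed.

Let cclosed (K : set T) : compact K -> closed K.
Proof. exact: compact_closed. Qed.

(* as kap <= M, the defect M - kap of an intersection is at most the sum of the
   two defects *)
Let kap_modular K K' : compact K -> compact K' ->
  kap K + kap K' <= kap (K `|` K') + kap (K `&` K').
Proof.
move=> cK cK'; apply/ler_addgt0Pr => e e0.
have cKK' : compact (K `&` K') by apply: compact_closedI => //; exact: cclosed.
have [D [cD DK lD]] := kap_diff cKK' cK (@subIsetl _ _ _) e0.
have : kap D + kap K' <= kap (D `|` K').
  apply: kap_disj => //; rewrite -subset0 => x [/DK[Kx nKK'] K'x].
  by apply: nKK'.
have : kap (D `|` K') <= kap (K `|` K').
  apply: kap_mono; [exact: compactU|exact: compactU|].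
  by move=> x [/DK[? _]|?]; [left|right].
move: lD; lra.
Qed.

Let kap_tight e : 0 < e -> exists2 K, compact K & M - e <= kap K.
Proof.
by move=> /L_tight[K cK h]; exists K => //; apply: kap_ge.
Qed.

Let cap (K : nat -> set T) n := \bigcap_(i in [set i | (i <= n)%N]) K i.

Let compact_cap K : (forall n, compact (K n)) -> forall n, compact (cap K n).
Proof.
move=> cK n; apply: subclosed_compact (cK 0%N) _.
  by apply: closed_bigI => i _; exact: cclosed.
by move=> x; apply.
Qed.

Let kap_cap K : (forall n, compact (K n)) -> forall n,
  M - kap (cap K n) <= \sum_(i < n.+1) (M - kap (K i)).
Proof.
move=> cK; elim=> [|n IH].
  rewrite big_ord_recl big_ord0 addr0 /= (_ : cap K 0 = K 0%N)//.
  apply/seteqP; split => [x|x K0 i]; first exact.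
  by rewrite /= leqn0 => /eqP ->.
rewrite big_ord_recr /=.
have -> : cap K n.+1 = cap K n `&` K n.+1.
  apply/seteqP; split => [x h|x [h h'] i /=].
    by split; [move=> i /= ni; exact: h (leqW ni) | exact: h (leqnn _)].
  by rewrite leq_eqVlt => /orP[/eqP->//|]; rewrite ltnS => /h.
have := kap_modular (@compact_cap K cK n) (cK n.+1).
have := kap_leM (compactU (@compact_cap K cK n) (cK n.+1)).
move: IH; lra.
Qed.

(* compactness: if an intersection lies in an open set, so does a finite one *)
Let kap_bigcap K : (forall n, compact (K n)) -> forall V, U V ->
  \bigcap_n K n `<=` V -> exists n, cap K n `<=` V.
Proof.
move=> cK V UV KV.
have /compact_near_coveringP cK0 := cK 0%N.
have [|N _ /(_ N (leqnn _)) h] := cK0 _ \oo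
    (fun n x => V x \/ exists2 i, (i <= n)%N & ~ K i x) _.
  move=> x K0x; have [Vx|nVx] := pselect (V x).
    exists (V, setT) => /=; last by move=> [? ?] [/= ? _]; left.
    by split; [exact: open_nbhs_nbhs (conj (U_open UV) Vx)|exact: filterT].
  have [i nKi] : exists i, ~ K i x.
    by apply/existsNP => h; apply: nVx; apply: KV => i _.
  exists (~` K i, [set n | (i <= n)%N]) => /=.
    split; last by exists i.
    by apply: open_nbhs_nbhs; split => //; exact: (closed_openC (cclosed (cK i))).
  by move=> [y n] [/= ? ?]; right; exists i.
exists N => x Kx; have [//|[i iN]] := h x (Kx 0%N (leq0n _)).
by case; exact: Kx.
Qed.

(* Outer measure as the complement of an inner measure.  This form makes
   countable subadditivity a statement about the intersection of a sequence of
   compact sets, settled by kap_cap and kap_bigcap. *)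
Let ext A : R := inf [set M - kap K | K in [set K | compact K /\ K `<=` ~` A]].

Let ext_lb A : lbound [set M - kap K | K in [set K | compact K /\ K `<=` ~` A]] 0.
Proof. by move=> _ [K [cK _] <-]; rewrite subr_ge0; exact: kap_leM. Qed.

Let ext_n0 A : [set M - kap K | K in [set K | compact K /\ K `<=` ~` A]] !=set0.
Proof. by exists (M - kap set0), set0 => //; split => //; exact: compact0. Qed.

Let ext_le A K : compact K -> K `<=` ~` A -> ext A <= M - kap K.
Proof.
by move=> cK KA; apply: ge_inf; [exists 0; exact: ext_lb|exists K].
Qed.

Let ext_ge A x : (forall K, compact K -> K `<=` ~` A -> x <= M - kap K) ->
  x <= ext A.
Proof.
move=> h; apply: lb_le_inf; first exact: ext_n0.
by move=> _ [V [UV KV] <-]; exact: h.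
Qed.

Let ext_approx A e : 0 < e ->
  exists K, [/\ compact K, K `<=` ~` A & M - kap K < ext A + e].
Proof.
move=> e0; have [_ [K [cK KA] <-] lK] := @inf_adherent _ _ e e0
  (conj (@ext_n0 A) (ex_intro _ 0 (@ext_lb A))).
by exists K.
Qed.

Let mu A := (ext A)%:E.

Let mu0 : mu set0 = 0%E.
Proof.
congr EFin; apply/eqP; rewrite eq_le; apply/andP; split; last first.
  by apply: ext_ge => K cK _; rewrite subr_ge0; exact: kap_leM.
apply/ler_addgt0Pr => e e0; have [K cK hK] := kap_tight e0.
apply: le_trans (ext_le cK _) _; first by rewrite setC0.
lra.
Qed.

Let mu_ge0 A : (0 <= mu A)%E.
Proof. by rewrite lee_fin; apply: lb_le_inf; [exact: ext_n0|exact: ext_lb]. Qed.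

Let mu_mono : {homo mu : A B / A `<=` B >-> (A <= B)%E}.
Proof.
move=> A B AB; rewrite lee_fin; apply: ext_ge => K cK KB; apply: ext_le => //.
by apply: subset_trans KB _; exact: subsetC.
Qed.

Let mu_sigma : sigma_subadditive mu.
Proof.
move=> F; apply/lee_addgt0Pr => e e0.
have /choice[K hK] n : exists K, [/\ compact K, K `<=` ~` F n &
    M - kap K < ext (F n) + e / (2 ^ n.+1)%:R].
  by apply: ext_approx; rewrite divr_gt0.
have cK n : compact (K n) by have [] := hK n.
apply: le_trans (epsilon_trick xpredT (fun n => mu_ge0 (F n)) (ltW e0)).
apply: (@le_trans _ _ (\sum_(i <oo) (M - kap (K i))%:E)%E); last first.
  apply: lee_nneseries => i _; first by rewrite lee_fin subr_ge0 kap_leM.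
  by rewrite /mu -EFinD lee_fin; have [_ _ /ltW] := hK i.
have cI : compact (\bigcap_n K n).
  apply: subclosed_compact (cK 0%N) _.
    by apply: closed_bigI => i _; exact: cclosed.
  by move=> x; apply.
apply: (@le_trans _ _ (M - kap (\bigcap_n K n))%:E).
  rewrite lee_fin; apply: ext_le => // x Kx [i _ Fx].
  by have [_ /(_ x (Kx i I))] := hK i.
rewrite EFinB; apply/lee_addgt0Pr => f f0.
have [V [UV KV _ lV]] := kap_approx cI openT (@subsetT _ _) f0.
have [n hn] := kap_bigcap cK UV KV.
apply: (@le_trans _ _ ((\sum_(i < n.+1) (M - kap (K i)))%:E + f%:E)%E).
  rewrite -EFinB -EFinD lee_fin.
  have := kap_cap cK n; have := kap_le UV hn; move: lV; lra.
apply: leeD => //; rewrite -sumEFin.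
rewrite -(big_mkord xpredT (fun i => (M - kap (K i))%:E)).
by apply: nneseries_lim_ge => i _ _; rewrite lee_fin subr_ge0 kap_leM.
Qed.

HB.instance Definition _ := isOuterMeasure.Build R T mu
  mu0 mu_ge0 mu_mono mu_sigma.

(* Given K compact outside A and S compact of nearly full content, the compact
   set (S `&` F) `|` K misses A outside F, and the part D of S that kap_diff
   leaves over, joined to K, misses A inside F.  D is disjoint from K, so the
   two contents add up to nearly M + kap K. *)
Let closed_cara F : closed F -> mu.-caratheodory F.
Proof.
move=> cF; apply: le_caratheodory_measurable => A.
rewrite -EFinD lee_fin; apply: ext_ge => K cK KA.
apply/ler_addgt0Pr => e e0; have e2 : 0 < e / 2 by rewrite divr_gt0.
have [S cS hS] := kap_tight e2.
have cSF : compact (S `&` F) by exact: compact_closedI.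
have cSFK : compact ((S `&` F) `|` K) by exact: compactU.
have cSK : compact (S `|` K) by exact: compactU.
have sub : (S `&` F) `|` K `<=` S `|` K.
  by move=> x [[? _]|?]; [left|right].
have [D [cD DS lD]] := kap_diff cSFK cSK sub e2.
have h1 : ext (A `&` ~` F) <= M - kap ((S `&` F) `|` K).
  apply: ext_le => // x [[_ Fx] [_]|Kx [Ax _]]; first exact.
  exact: (KA x).
have h2 : ext (A `&` F) <= M - kap (D `|` K).
  apply: ext_le; first exact: compactU.
  move=> x [/DS[] [Sx|Kx] + [Ax Fx]|Kx [Ax _]]; last exact: (KA x).
  - by apply; left.
  - by apply; right.
have : kap D + kap K <= kap (D `|` K).
  apply: kap_disj => //; rewrite -subset0 => x [/DS[_ +] Kx].
  by apply; right.
have : kap S <= kap (S `|` K) by apply: kap_mono => // ?; left.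
move: hS lD h1 h2; lra.
Qed.

Let borel_cara (A : set (borel T)) : measurable A -> mu.-caratheodory A.
Proof.
move=> mA; suff : (@measurable _ (borel T)) `<=`
    (measurable : set (set (caratheodory_type mu))) by move=> /(_ _ mA).
apply: smallest_sub; first exact: sigma_algebra_measurable.
move=> O oO; rewrite -(setCK O); apply: measurableC.
by apply: closed_cara; exact: open_closedC.
Qed.

Let nu (A : set (borel T)) := mu A.

Let nu_sigma : semi_sigma_additive nu.
Proof.
move=> F mF tF mUF; apply: (@caratheodory_measure_sigma_additive R T mu F) => //.
  by move=> i; exact: borel_cara (mF i).
exact: borel_cara.
Qed.

HB.instance Definition _ := isMeasure.Build _ (borel T) R nu
  mu0 mu_ge0 nu_sigma.

Let nu_fin : fin_num_fun nu.
Proof. by []. Qed.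

HB.instance Definition _ := @Measure_isFinite.Build _ (borel T) R nu nu_fin.

Let nuT : nu setT = M%:E.
Proof.
congr EFin; apply/eqP; rewrite eq_le; apply/andP; split.
  by rewrite -[leRHS]subr0 -kap0; apply: ext_le => //; exact: compact0.
apply: ext_ge => K cK; rewrite setCT subset0 => ->; rewrite kap0; lra.
Qed.

Let nuC (A : set (borel T)) : measurable A -> ext A + ext (~` A) = M.
Proof.
move=> mA; apply: EFin_inj; rewrite -nuT EFinD.
by have := borel_cara mA setT; rewrite !setTI => h; exact: esym h.
Qed.

Let nuK (K : set T) : compact K -> ext K = kap K.
Proof.
move=> cK; apply/eqP; rewrite eq_le; apply/andP; split.
  apply: kap_ge => // V UV KV; apply/ler_addgt0Pr => e e0.
  have [S cS hS] := kap_tight e0.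
  have cSV : compact (S `\` V).
    by rewrite setDE; apply: compact_closedI => //; exact/open_closedC/U_open.
  apply: le_trans (ext_le cSV _) _; first by move=> x [_ nV] /KV.
  suff : kap S <= L V + kap (S `\` V) by move: hS; lra.
  rewrite addrC -lerBlDr; apply: kap_ge => // W UW SW.
  have : kap S <= L (V `|` W).
    apply: kap_le; first exact: U_union.
    by move=> x Sx; have [?|?] := pselect (V x); [left|right; exact: SW].
  move=> /le_trans/(_ (L_subadd UV UW)); lra.
apply: ext_ge => S cS SK.
have : kap K + kap S <= kap (K `|` S).
  by apply: kap_disj => //; rewrite -subset0 => x [Kx /SK].
have := kap_leM (compactU cK cS); lra.
Qed.

Let nu_radon : is_radon nu.
Proof.
move=> B mB e e0; have [K [cK KB lK]] := @ext_approx (~` B) e e0.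
rewrite setCK in KB.
exists K; split => //.
have mK : measurable (K : set (borel T)).
  rewrite -(setCK K); apply: measurableC; apply: sub_sigma_algebra.
  by rewrite openC; exact: cclosed.
have := borel_cara mK B; rewrite (_ : B `&` K = K); last exact/setIidPr.
rewrite /nu /mu -EFinD => -[BK]; rewrite lee_fin setDE.
have := nuC mB; have := nuK cK; move: BK lK; lra.
Qed.

(** The measure is the restriction to Borel sets of the outer measure ext; it
    is finite, and compact sets are measured by kap, so ext is inner regular
    by its very definition. *)
Lemma radon_of_content : exists rho : radon_measure R T,
  rho setT = M%:E /\ forall V, U V -> (rho V <= (L V)%:E)%E.
Proof.
exists (RadonMeasure nu_radon); split => [|V UV]; first exact: nuT.
have mV : measurable (V : set (borel T)) by apply: sub_sigma_algebra; exact: U_open.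
rewrite /= /nu /mu lee_fin; apply/ler_addgt0Pr => e e0.
have [K [cK KV lK]] := @ext_approx (~` V) e e0.
rewrite setCK in KV.
have := nuC mV; have := kap_le UV KV; move: lK; lra.
Qed.

End content.

(** * Change of variables and Borel functions *)

Import HBNNSimple.

(** The measure nu is characterized by its values on measurable sets rather than
    constructed, so that the formula applies both to images of Radon measures
    and to the homogeneous marginals of a plan, whose weight is r ^+ 2. *)
Section change_of_variables.
Context d d' (T : measurableType d) (T' : measurableType d') (R : realType).
Variables (mu : {measure set T -> \bar R}) (nu : {measure set T' -> \bar R}).
Variables (D : set T) (mD : measurable D) (w : T -> R) (f : T -> T').
Hypothesis w0 : forall x, D x -> 0 <= w x.
Hypothesis mw : measurable_fun D w.
Hypothesis mf : measurable_fun D f.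
Hypothesis nuE : forall B, measurable B ->
  nu B = (\int[mu]_(x in D `&` f @^-1` B) (w x)%:E)%E.
Local Open Scope ereal_scope.

Let mwE : measurable_fun D (EFin \o w).
Proof. exact/measurable_EFinP. Qed.

Let change_nnsfun (h : {nnsfun T' >-> R}) :
  \int[nu]_y (h y)%:E = \int[mu]_(x in D) ((w x)%:E * (h (f x))%:E).
Proof.
rewrite integralT_nnsfun sintegralE.
transitivity (\int[mu]_(x in D) (\sum_(r \in range h)
    (r%:E * ((w x)%:E * (\1_(f @^-1` (h @^-1` [set r])) x)%:E)))); last first.
  apply: eq_integral => x /[!inE] Dx.
  under eq_fsbigr do rewrite muleCA -[in X in (_ * X)%E]EFinM.
  rewrite -ge0_mule_fsumr; last first.
    by move=> r; exact: (nnfun_muleindic_ge0 h r (f x)).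
  by rewrite fsumEFin// [in RHS](fimfunE h).
have mfr r : measurable (D `&` f @^-1` (h @^-1` [set r])).
  by apply: mf => //; exact: measurable_funPTI.
have mI r : measurable_fun D
    (fun x => (\1_(f @^-1` (h @^-1` [set r])) x)%:E : \bar R).
  apply/measurable_EFinP.
  apply: (@measurable_comp _ _ _ _ _ _ setT (\1_(h @^-1` [set r]) : T' -> R) _ f) => //.
rewrite ge0_integral_fsum//; last 2 first.
- move=> r; apply: measurable_funeM; exact: emeasurable_funM.
- move=> r x Dx.
  have [->|h0] := eqVneq (\1_(f @^-1` (h @^-1` [set r])) x) (0%R : R).
    by rewrite !mule0.
  have : (f @^-1` (h @^-1` [set r])) x.
    by move: h0; rewrite indicE; case: (boolP (_ \in _)) => [/[!inE]//|]; rewrite eqxx.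
  by move=> /= <-; rewrite !mule_ge0// lee_fin// w0.
apply: eq_fsbigr => r /[!inE] -[y _ hy].
have r0 : (0 <= r)%R by rewrite -hy.
rewrite ge0_integralZl//; last 2 first.
- exact: emeasurable_funM.
- by move=> x Dx; rewrite mule_ge0// lee_fin ?w0.
rewrite nuE; last exact: measurable_funPTI.
congr (_ * _); rewrite integral_mkcondr; apply: eq_integral => x _.
by rewrite patchE indicE; case: ifPn => _; rewrite ?mule1 ?mule0.
Qed.

Lemma ge0_integral_change_of_variables (g : T' -> \bar R) :
  measurable_fun setT g -> (forall y, 0 <= g y) ->
  \int[nu]_y g y = \int[mu]_(x in D) ((w x)%:E * g (f x)).
Proof.
move=> mg g0; pose h := nnsfun_approx measurableT mg.
have hE y : EFin \o h^~ y @ \oo --> g y by exact: cvg_nnsfun_approx.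
transitivity (limn (fun n => \int[nu]_y (h n y)%:E)).
  under eq_integral => y _ do rewrite -(cvg_lim _ (hE y))//.
  apply: monotone_convergence => //.
  - by move=> n; exact/measurable_EFinP.
  - by move=> n x _; rewrite lee_fin.
  - by move=> x _ a b ab; rewrite lee_fin; exact/lefP/nd_nnsfun_approx.
transitivity (limn (fun n => \int[mu]_(x in D) ((w x)%:E * (h n (f x))%:E))).
  by congr (limn _); apply/funext => n; exact: change_nnsfun.
have wE x : (fun n => (w x)%:E * (h n (f x))%:E) @ \oo --> (w x)%:E * g (f x).
  by apply: cvgeZl => //; exact: hE.
under [RHS]eq_integral => x _ do rewrite -(cvg_lim _ (wE x))//.
apply/esym/monotone_convergence => //.
- move=> n; apply: emeasurable_funM => //; apply/measurable_EFinP.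
  by apply: (@measurable_comp _ _ _ _ _ _ setT (h n)).
- by move=> n x Dx; rewrite mule_ge0// lee_fin// w0.
- move=> x Dx a b ab; rewrite lee_wpmul2l ?lee_fin ?w0//.
  exact/lefP/nd_nnsfun_approx.
Qed.

End change_of_variables.

Section borel.
Context {R : realType}.
Implicit Types T : ptopologicalType.

Lemma open_borel T (A : set T) : open A -> measurable (A : set (borel T)).
Proof. exact: sub_sigma_algebra. Qed.

Lemma closed_borel T (A : set T) : closed A -> measurable (A : set (borel T)).
Proof.
by move=> cA; rewrite -(setCK A); apply: measurableC; apply: open_borel; rewrite openC.
Qed.

Lemma compact_borel T (A : set T) : hausdorff_space T -> compact A ->
  measurable (A : set (borel T)).
Proof. by move=> hT cA; apply: closed_borel; exact: compact_closed. Qed.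

Lemma within_continuous_borel T T' (D : set T) (f : T -> T') :
  measurable (D : set (borel T)) -> {within D, continuous f} ->
  measurable_fun (D : set (borel T)) (f : borel T -> borel T').
Proof.
move=> mD /continuousP cf; apply: (@measurability _ _ (borel T) (borel T') D f (@open T')) => //.
move=> _ [A oO <-]; have /open_subspaceP[V oV VD] := cf _ oO.
rewrite setIC -VD; apply: measurableI => //; exact: open_borel.
Qed.

Lemma in_continuous_within T (T' : topologicalType) (D : set T) (f : T -> T') :
  {in D, continuous f} -> {within D, continuous f}.
Proof. exact: continuous_in_subspaceT. Qed.

Lemma continuous_borel T T' (f : T -> T') :
  continuous f -> measurable_fun setT (f : borel T -> borel T').
Proof.
by move=> cf; apply: within_continuous_borel => //; apply: in_continuous_within.
Qed.

Lemma within_continuous_borelR T (D : set T) (f : T -> R) :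
  measurable (D : set (borel T)) -> {within D, continuous f} ->
  measurable_fun (D : set (borel T)) (f : borel T -> R).
Proof.
move=> mD /continuousP cf; apply: (measurability _ (RGenOpens.measurableE R)).
move=> _ [_ [a [b ->]] <-]; have /open_subspaceP[V oV VD] := cf _ (@interval_open R (BRight a) (BLeft b) isT isT).
rewrite setIC -VD; apply: measurableI => //; exact: open_borel.
Qed.

Lemma continuous_borelR T (f : T -> R) :
  continuous f -> measurable_fun setT (f : borel T -> R).
Proof.
by move=> cf; apply: within_continuous_borelR => //; apply: in_continuous_within.
Qed.

End borel.

(** * Weighted images and sums of Radon measures *)

(** Continuity of f is required on D only: the base point of a cone point is
    continuous away from the vertex and nowhere else. *)
Section push.
Context {R : realType} {T T' : ptopologicalType}.
Hypothesis hT : hausdorff_space T.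
Hypothesis hT' : hausdorff_space T'.
Variables (rho : radon_measure R T) (D : set T) (w : T -> R) (f : T -> T').
Hypothesis mD : measurable (D : set (borel T)).
Hypothesis w0 : forall x, D x -> 0 <= w x.
Hypothesis mw : measurable_fun (D : set (borel T)) (w : borel T -> R).
Hypothesis iw : (\int[rho]_(x in D) (w x)%:E < +oo)%E.
Hypothesis cf : {within D, continuous f}.

Let mf : measurable_fun (D : set (borel T)) (f : borel T -> borel T').
Proof. exact: within_continuous_borel. Qed.

Let mwE : measurable_fun (D : set (borel T)) (EFin \o w : borel T -> \bar R).
Proof. exact/measurable_EFinP. Qed.

Let wE0 x : D x -> (0 <= (w x)%:E)%E.
Proof. by move=> Dx; rewrite lee_fin w0. Qed.

Let m (B : set (borel T')) : \bar R :=
  (\int[rho]_(x in (D `&` f @^-1` B : set (borel T))) (w x)%:E)%E.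

Let mfB (B : set (borel T')) : measurable B ->
  measurable (D `&` f @^-1` B : set (borel T)).
Proof. by move=> mB; exact: mf. Qed.

Let m0 : m set0 = 0%E.
Proof. by rewrite /m preimage_set0 setI0 integral_set0. Qed.

Let m_ge0 B : (0 <= m B)%E.
Proof. by apply: integral_ge0 => x [Dx _]; exact: wE0. Qed.

Let m_sigma : semi_sigma_additive m.
Proof.
move=> F mF tF mUF; rewrite /m preimage_bigcup setI_bigcupr.
rewrite ge0_integral_bigcup//=.
- by apply: is_cvg_ereal_nneg_natsum_cond => n _ _; exact: m_ge0.
- by move=> k; exact: mfB.
- apply: measurable_funS mwE => //; apply: bigcup_sub => k _; exact: subIsetl.
- by move=> x [k _ [Dx _]]; exact: wE0.
- apply: trivIset_setIl; apply/trivIsetP => i j _ _ ij.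
  rewrite -preimage_setI; move/trivIsetP: tF => /(_ i j I I ij) ->.
  by rewrite preimage_set0.
Qed.

HB.instance Definition _ := isMeasure.Build _ (borel T') R m m0 m_ge0 m_sigma.

Let m_le A : measurable (A : set (borel T)) -> A `<=` D ->
  (\int[rho]_(x in A) (w x)%:E < +oo)%E.
Proof.
move=> mA AD; apply: le_lt_trans iw; exact: ge0_subset_integral.
Qed.

Let m_fin : fin_num_fun m.
Proof.
move=> B mB; rewrite ge0_fin_numE//; apply: m_le; first exact: mfB.
exact: subIsetl.
Qed.

HB.instance Definition _ := @Measure_isFinite.Build _ (borel T') R m m_fin.

(* The density w may be unbounded.  The sets where w <= n exhaust E, and on such
   a set the w-measure is at most n times rho. *)
Let density_inner (E : set (borel T)) (e : R) : measurable E -> E `<=` D ->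
  0 < e -> exists K : set T, [/\ compact K, K `<=` E &
    (\int[rho]_(x in E `\` K) (w x)%:E <= e%:E)%E].
Proof.
move=> mE ED e0; have e20 : 0 < e / 2 by rewrite divr_gt0.
pose F (n : nat) : set (borel T) := E `&` [set x | w x <= n%:R].
have mF n : measurable (F n).
  have -> : F n = E `&` (D `&` w @^-1` `]-oo, n%:R]).
    apply/seteqP; split => x; rewrite /F /= in_itv /=.
      by move=> [Ex wx]; split => //; split => //; exact: ED.
    by move=> [? []].
  by apply: measurableI => //; apply: mw.
have FE n : F n `<=` E by exact: subIsetl.
have FD n : F n `<=` D by exact: subset_trans (FE n) ED.
have UF : \bigcup_n F n = E.
  apply/seteqP; split=> [x [n _] /FE//|x Ex].
  exists (Num.trunc (w x)).+1 => //; split => //=; apply/ltW.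
  exact: truncnS_gt.
have If : (\int[rho]_(x in E) (w x)%:E)%E \is a fin_num.
  by rewrite ge0_fin_numE; [exact: m_le|apply: integral_ge0 => x /ED; exact: wE0].
have [n Fn] : exists n, (\int[rho]_(x in E) (w x)%:E - (e / 2)%:E <=
    \int[rho]_(x in F n) (w x)%:E)%E.
  apply: contrapT => /forallNP h.
  have : (\int[rho]_(x in F n) (w x)%:E)%E @[n --> \oo] -->
      (\int[rho]_(x in E) (w x)%:E)%E.
    rewrite -UF; apply: ge0_nondecreasing_set_cvg_integral => //.
    - apply/nondecreasing_seqP => k; apply/subsetPset => x [Ex wx]; split => //=.
      by apply: le_trans wx _; rewrite ler_nat.
    - by move=> i; apply: measurable_funS mwE.
    - by move=> i x /FD; exact: wE0.
  move=> cv.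
  have hn : \forall x \near \oo, (\int[rho]_(x in F x) (w x)%:E <=
      \int[rho]_(x in E) (w x)%:E - (e / 2)%:E)%E.
    by apply: nearW => n; apply/ltW; rewrite ltNge; apply/negP; exact: h.
  have := [elaborate cvge_le hn cv].
  by rewrite -(fineK If) -EFinB lee_fin lerBrDr gerDl leNgt e20.
have e3 : 0 < e / 2 / n.+1%:R by rewrite divr_gt0.
have [K [cK KF lK]] := radonP rho (mF n) e3.
have mK : measurable (K : set (borel T)) by exact: compact_borel.
exists K; split => //; first exact: subset_trans (FE n).
have -> : E `\` K = (E `\` F n) `|` (F n `\` K).
  apply/seteqP; split => x.
    by move=> [Ex nK]; have [?|?] := pselect (F n x); [right|left].
  by move=> [[Ex nF]|[/FE Ex nK]]; split => // /KF.
rewrite ge0_integral_setU//=; last 5 first.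
- exact: measurableD.
- exact: measurableD.
- by apply: measurable_funS mwE => // x [[/ED]|[/FD]].
- by move=> x [[/ED Dx _]|[/FD Dx _]]; exact: wE0.
- by rewrite disj_set2E; apply/eqP/seteqP; split => // x [[_ nF] []].
have h1 : (\int[rho]_(x in E `\` F n) (w x)%:E <= (e / 2)%:E)%E.
  move: Fn; have -> : (\int[rho]_(x in E) (w x)%:E =
      \int[rho]_(x in E `\` F n) (w x)%:E + \int[rho]_(x in F n) (w x)%:E)%E.
    rewrite -ge0_integral_setU//=.
    - by rewrite setDKU.
    - exact: measurableD.
    - by rewrite setDKU//; apply: measurable_funS mwE.
    - by move=> x [[/ED Dx _]|/FD Dx]; exact: wE0.
    - by rewrite disj_set2E; apply/eqP/seteqP; split => // x [[_ nF]].
  have f1 : (\int[rho]_(x in F n) (w x)%:E)%E \is a fin_num.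
    by rewrite ge0_fin_numE; [exact: m_le|apply: integral_ge0 => x /FD; exact: wE0].
  have f2 : (\int[rho]_(x in E `\` F n) (w x)%:E)%E \is a fin_num.
    rewrite ge0_fin_numE; first by apply: m_le; [exact: measurableD|move=> x [/ED]].
    by apply: integral_ge0 => x [/ED Dx _]; exact: wE0.
  rewrite -(fineK f1) -(fineK f2) -!EFinD -?EFinB !lee_fin; lra.
have h2 : (\int[rho]_(x in F n `\` K) (w x)%:E <= (e / 2)%:E)%E.
  apply: (@le_trans _ _ (\int[rho]_(x in F n `\` K) (n%:R)%:E)%E).
    apply: ge0_le_integral => //=.
    - exact: measurableD.
    - by move=> x [/FD Dx _]; exact: wE0.
    - by apply: measurable_funS mwE => // x [/FD].
    - by move=> x [[_ /=]]; rewrite lee_fin.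
  rewrite integral_cst; last exact: measurableD.
  apply: le_trans (lee_wpmul2l _ lK) _; first by rewrite lee_fin.
  rewrite -EFinM lee_fin mulrCA -[leRHS]mulr1 ler_wpM2l ?(ltW e20)//.
  by rewrite ler_pdivrMr// mul1r ler_nat.
apply: le_trans (leeD h1 h2) _.
by rewrite -EFinD lee_fin -splitr.
Qed.

Let m_radon : is_radon m.
Proof.
move=> B mB e e0.
have [K [cK KE lK]] := density_inner (mfB mB) (@subIsetl _ _ _) e0.
have KD : K `<=` D by move=> x /KE[].
have cfK : compact (f @` K).
  apply: continuous_compact cK; exact: continuous_subspaceW cf.
exists (f @` K); split => //; first by move=> _ [x /KE[_ ?] <-].
apply: le_trans lK; apply: ge0_subset_integral => //=.
- by apply: mfB; apply: measurableD => //; exact: compact_borel.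
- by apply: measurableD; [exact: mfB|exact: compact_borel].
- by apply: measurable_funS mwE => // x [[]].
- by move=> x [[Dx _] _]; exact: wE0.
- by move=> x [Dx [Bfx nK]]; split => // Kx; apply: nK; exists x.
Qed.

(** Inner regularity survives because f maps a compact subset of D to a compact
    set: if K nearly exhausts the part of D over B, then f @` K nearly
    exhausts B. *)
Lemma radon_push : exists nu : radon_measure R T',
  forall g : borel T' -> \bar R, measurable_fun setT g -> (forall y, (0 <= g y)%E) ->
  (\int[nu]_y g y = \int[rho]_(x in D) ((w x)%:E * g (f x)))%E.
Proof.
exists (RadonMeasure m_radon) => g mg g0 /=.
exact: (@ge0_integral_change_of_variables _ _ (borel T) (borel T') R rho m D mD w f).
Qed.

End push.

Section add.
Context {R : realType} {T : ptopologicalType}.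
Hypothesis hT : hausdorff_space T.
Variables rho1 rho2 : radon_measure R T.

Let m : set (borel T) -> \bar R := measure_add rho1 rho2.

Let mE A : m A = (rho1 A + rho2 A)%E.
Proof. exact: measure_addE. Qed.

Let m_fin : fin_num_fun m.
Proof. by move=> A mA; rewrite mE fin_numD !fin_num_measure. Qed.

HB.instance Definition _ := Measure.on m.
HB.instance Definition _ := @Measure_isFinite.Build _ (borel T) R m m_fin.

Let m_radon : is_radon m.
Proof.
  move=> B mB e e0; have e2 : 0 < e / 2 by rewrite divr_gt0.
  have [K1 [cK1 K1B l1]] := radonP rho1 mB e2.
  have [K2 [cK2 K2B l2]] := radonP rho2 mB e2.
  have cK : compact (K1 `|` K2) by exact: compactU.
  exists (K1 `|` K2); split => //; first by rewrite subUset.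
  rewrite [X in (X <= _)%E](mE _) (splitr e) EFinD; apply: leeD.
    apply: le_trans l1; apply: le_measure; rewrite ?inE; last by move=> x [? nK]; split => // ?; apply: nK; left.
      by apply: measurableD => //; exact: compact_borel.
    by apply: measurableD => //; exact: compact_borel.
  apply: le_trans l2; apply: le_measure; rewrite ?inE; last by move=> x [? nK]; split => // ?; apply: nK; right.
    by apply: measurableD => //; exact: compact_borel.
  by apply: measurableD => //; exact: compact_borel.
Qed.

Lemma radon_add : exists nu : radon_measure R T,
  forall g : borel T -> \bar R, measurable_fun setT g -> (forall y, (0 <= g y)%E) ->
  (\int[nu]_y g y = \int[rho1]_y g y + \int[rho2]_y g y)%E.
Proof.
exists (RadonMeasure m_radon) => g mg g0 /=.
exact: ge0_integral_measure_add.
Qed.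

End add.

(** * Finite partitions into cells *)

Lemma hausdorff_prod (T U : topologicalType) :
  hausdorff_space T -> hausdorff_space U -> hausdorff_space (T * U)%type.
Proof.
move=> hT hU [a b] [c d] h; congr pair.
  apply: hT => A B Aa Bc.
  have [] := h (A `*` setT) (B `*` setT).
  - by exists (A, setT) => //; split => //; exact: filterT.
  - by exists (B, setT) => //; split => //; exact: filterT.
  - by move=> [x y] [[? _] [? _]]; exists x.
apply: hU => A B Aa Bc.
have [] := h (setT `*` A) (setT `*` B).
- by exists (setT, A) => //; split => //; exact: filterT.
- by exists (setT, B) => //; split => //; exact: filterT.
- by move=> [x y] [[_ ?] [_ ?]]; exists y.
Qed.

(** The image of an ultrafilter is an ultrafilter on the compact `[a, b]. *)
Lemma ultra_bounded_cvg (R : realType) (I : Type) (F : set_system I)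
    (u : I -> R) (a b : R) : UltraFilter F ->
  (forall i, a <= u i <= b) -> cvg (u i @[i --> F]).
Proof.
move=> UF uab.
have UG : UltraFilter (u @ F).
  split => [|G PG FG]; first exact: fmap_proper_filter.
  apply/seteqP; split => // A GA; have [//|FA] := in_ultra_setVsetC (u @^-1` A) UF.
  exfalso; have GCA : G (~` A) by apply: FG.
  by have /filter_ex[x []] := [elaborate filterI GA GCA].
have : compact `[a, b] by exact: segment_compact.
rewrite compact_ultra => /(_ (u @ F) UG)[|l [_ ul]].
  have : F (u @^-1` `[a, b]) by apply: filterE => i; rewrite /= in_itv /=.
  exact.
by apply/cvg_ex; exists l.
Qed.

Section cells.
Context {Y : ptopologicalType}.
Implicit Types s : seq (set Y).

(** The number of the block containing y in the partition generated by the
    members of s: bit i records whether y belongs to the i-th of them.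
    Interiors make all blocks Borel, whatever sets s contains. *)
Fixpoint cell s (y : Y) : nat :=
  if s is A :: s' then (`[< interior A y >] + (cell s' y).*2)%N else 0%N.

Lemma cell_lt s y : (cell s y < 2 ^ size s)%N.
Proof.
elim: s => //= A s IH; rewrite expnS mul2n.
by case: asboolP => _; rewrite ?add0n ?add1n ?ltn_double// ltn_Sdouble.
Qed.

Lemma cell_separates s A y z : open A -> A \in s -> cell s y = cell s z ->
  A y -> A z.
Proof.
move=> oA; elim: s => //= B s IH; rewrite inE => As yz.
have eqh : cell s y = cell s z.
  by move/(congr1 half): yz; rewrite !half_bit_double.
case/orP: As => [/eqP AB|As]; last exact: IH.
move/(congr1 odd): yz; rewrite !oddD !odd_double !addbF !oddb -AB.
have -> : interior A = A by exact/interior_id.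
by case: asboolP => // ?; case: asboolP.
Qed.

Lemma measurable_cell s k : measurable (cell s @^-1` [set k] : set (borel Y)).
Proof.
elim: s k => [|A s IH] k.
  have [->|k0] := eqVneq k 0%N; first by rewrite (_ : _ @^-1` _ = setT)//; apply/seteqP; split.
  rewrite (_ : _ @^-1` _ = set0)//; apply/seteqP; split => // y /= /esym/eqP.
  by rewrite (negbTE k0).
have mA : measurable (interior A : set (borel Y)) by apply: open_borel; exact: open_interior.
rewrite (_ : _ @^-1` _ = (cell s @^-1` [set k./2]) `&`
    (if odd k then interior A else ~` interior A)); last first.
  apply/seteqP; split => y /=.
    move=> <-; rewrite half_bit_double oddD odd_double addbF oddb; split => //.
    by case: asboolP.
  move=> [-> hy]; rewrite -[RHS]odd_double_half; congr (_ + _)%N.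
  by move: hy; case: odd => [?|?]; case: asboolP.
apply: measurableI; first exact: IH.
by case: odd => //; exact: measurableC.
Qed.

End cells.

Section refinement_filter.
Context {Y : ptopologicalType}.

(** Eventual behavior under adding sets to a list, which refines its partition. *)
Definition refinements : set_system (seq (set Y)) :=
  [set S | exists s0 : seq (set Y), forall s : seq (set Y),
    {subset s0 <= s} -> S s].

Lemma refinements_filter : ProperFilter refinements.
Proof.
apply: Build_ProperFilter_ex; first by move=> S [s0 h]; exists s0; exact: h.
split.
- by exists [::].
- move=> A B [s hA] [t hB]; exists (s ++ t) => u stu.
  split; [apply: hA|apply: hB] => x xs; apply: stu; rewrite mem_cat xs ?orbT//.
- by move=> A B AB [s hA]; exists s => t /hA /AB.
Qed.

End refinement_filter.

Lemma sum_cells (R : realType) d (T : measurableType d) (Y : ptopologicalType)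
    (mu : {finite_measure set T -> \bar R}) (p : T -> borel Y) (s : seq (set Y))
    (A : set T) : measurable_fun setT p -> measurable A ->
  \sum_(k < 2 ^ size s) fine (mu (A `&` p @^-1` (cell s @^-1` [set val k]))) =
  fine (mu A).
Proof.
move=> mp mA.
have mB k : measurable (A `&` p @^-1` (cell s @^-1` [set k])).
  apply: measurableI => //; rewrite -[X in measurable X]setTI.
  by apply: mp => //; exact: measurable_cell.
rewrite -[in RHS](_ : \big[setU/set0]_(k < 2 ^ size s)
    (A `&` p @^-1` (cell s @^-1` [set val k])) = A); last first.
  rewrite -(bigcup_mkord _ (fun k => A `&` p @^-1` (cell s @^-1` [set k]))).
  rewrite -setI_bigcupr; apply/setIidPl => x _.
  by exists (cell s (p x)) => //=; exact: cell_lt.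
rewrite (@measure_bigsetU _ _ _ mu (fun k => A `&` p @^-1` (cell s @^-1` [set k])))//.
- by rewrite sum_fine// => i _; rewrite fin_num_measure.
- apply/trivIsetP => i j _ _ /eqP ij; rewrite -subset0 => x [[_ /= xi] [_ /= xj]].
  by apply: ij; rewrite -xi.
Qed.

Section finitely_additive.
Context d (T : measurableType d) (R : realType) (G : set T -> R).
Hypothesis G_ge0 : forall A, measurable A -> 0 <= G A.
Hypothesis G_add : forall A B, measurable A -> measurable B -> A `&` B = set0 ->
  G (A `|` B) = G A + G B.

Lemma finitely_additive_mono A B : measurable A -> measurable B -> A `<=` B ->
  G A <= G B.
Proof.
move=> mA mB AB; have mBA : measurable (B `\` A) by exact: measurableD.
by rewrite -(setDUK AB) G_add ?setDIK// lerDl G_ge0.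
Qed.

Lemma finitely_additive_subadd A B : measurable A -> measurable B ->
  G (A `|` B) <= G A + G B.
Proof.
move=> mA mB; have mBA : measurable (B `\` A) by exact: measurableD.
have -> : A `|` B = A `|` (B `\` A).
  apply/seteqP; split => x; last by case=> [?|[? _]]; [left|right].
  by have [?|?] := pselect (A x); [left|case=> // ?; right].
by rewrite G_add ?setDIK// lerD2l finitely_additive_mono//; exact: subDsetl.
Qed.

End finitely_additive.

(** As the total masses agree, domination on open sets is reversed on closed
    sets, in particular on compact sets; by inner regularity of nu it is then
    reversed on all Borel sets, and passing to complements gives equality. *)
Lemma pushforward_radon_eq (R : realType) (T Z : ptopologicalType)
    (hZ : hausdorff_space Z) (rho : {finite_measure set (borel T) -> \bar R})
    (nu : radon_measure R Z) (f : T -> Z) : continuous f ->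
  rho setT = nu setT -> (forall V, open V -> (rho (f @^-1` V) <= nu V)%E) ->
  forall B : set (borel Z), measurable B -> rho (f @^-1` B) = nu B.
Proof.
move=> cf rhoT rhoV.
have mf (B : set (borel Z)) : measurable B -> measurable (f @^-1` B : set (borel T)).
  move=> mB; rewrite -[X in measurable X]setTI.
  exact: (continuous_borel cf).
have Crho (B : set (borel Z)) : measurable B ->
    fine (rho (f @^-1` B)) + fine (rho (f @^-1` (~` B))) = fine (rho setT).
  move=> mB; have m1 := mf _ mB; have m2 := mf _ (measurableC mB).
  rewrite -fineD ?fin_num_measure// -measureU//; last first.
    by rewrite preimage_setC setICr.
  by rewrite preimage_setC setUCr.
have Cnu (B : set (borel Z)) : measurable B ->
    fine (nu B) + fine (nu (~` B)) = fine (nu setT).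
  move=> mB; have m1 := measurableC mB.
  by rewrite -fineD ?fin_num_measure// -measureU ?setUCr// setICr.
have le (B : set (borel Z)) : measurable B -> fine (nu B) <= fine (rho (f @^-1` B)).
  move=> mB; apply/ler_addgt0Pr => e e0.
  have [K [cK KB lK]] := radonP nu mB e0.
  have mK : measurable (K : set (borel Z)) by exact: compact_borel.
  have h1 : fine (rho (f @^-1` K)) <= fine (rho (f @^-1` B)).
    have m1 := mf _ mB; have m2 := mf _ mK.
    apply: fine_le; rewrite ?fin_num_measure//.
    by apply: le_measure; rewrite ?inE// => x; exact: KB.
  have h2 : fine (rho (f @^-1` (~` K))) <= fine (nu (~` K)).
    have m1 := mf _ (measurableC mK); have m2 := measurableC mK.
    apply: fine_le; rewrite ?fin_num_measure//.
    by apply: rhoV; rewrite openC; exact: compact_closed.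
  have h3 : fine (nu B) = fine (nu K) + fine (nu (B `\` K)).
    have m1 : measurable (B `\` K) by exact: measurableD.
    by rewrite -fineD ?fin_num_measure// -measureU ?setDUK// setDIK.
  have h4 : fine (nu (B `\` K)) <= e.
    by rewrite -lee_fin fineK// fin_num_measure//; exact: measurableD.
  have := Crho _ mK; have := Cnu _ mK; rewrite rhoT; lra.
move=> B mB; rewrite -[LHS]fineK ?fin_num_measure//; last exact: mf.
rewrite -[RHS]fineK ?fin_num_measure//; congr EFin.
have := le _ mB; have := le _ (measurableC mB).
have := Crho _ mB; have := Cnu _ mB; rewrite rhoT => h1 h2 h3 h4.
by apply/eqP; rewrite eq_le; apply/andP; split; lra.
Qed.

(** * Gluing Radon measures along a common marginal *)

Section glue.
Context {R : realType} {P Q Y : ptopologicalType}.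
Hypothesis hP : hausdorff_space P.
Hypothesis hQ : hausdorff_space Q.
Hypothesis hY : hausdorff_space Y.
Variables (p : P -> Y) (q : Q -> Y).
Hypothesis cp : continuous p.
Hypothesis cq : continuous q.
Variables (alpha : radon_measure R P) (beta : radon_measure R Q).
Hypothesis marginal : forall B : set (borel Y), measurable B ->
  alpha (p @^-1` B) = beta (q @^-1` B).

Let mp : measurable_fun setT (p : borel P -> borel Y).
Proof. exact: continuous_borel. Qed.

Let mq : measurable_fun setT (q : borel Q -> borel Y).
Proof. exact: continuous_borel. Qed.

Let hW : hausdorff_space (P * Q)%type.
Proof. exact: hausdorff_prod. Qed.

(* Products of measures live on the product of the two Borel sigma-algebras,
   which may be smaller than the Borel sigma-algebra of P * Q. *)
Let PP : measurableType _ := (borel P * borel Q)%type.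

Let prodm (A : set PP) : R := fine ((alpha \x beta)%E A).

Let M := fine (alpha setT).

Let betaT : beta setT = alpha setT.
Proof. by have := marginal measurableT; rewrite !preimage_setT. Qed.

Let prodm_fin (A : set PP) : measurable A -> (alpha \x beta)%E A \is a fin_num.
Proof.
move=> mA; rewrite ge0_fin_numE//.
apply: (@le_lt_trans _ _ ((alpha \x beta)%E (setT `*` setT))).
  by apply: le_measure; rewrite ?inE// setXTT.
rewrite product_measure1E// lte_mul_pinfty//.
  by rewrite fin_num_measure.
by rewrite -ge0_fin_numE// fin_num_measure.
Qed.

Let prodmU (A B : set PP) : measurable A -> measurable B -> A `&` B = set0 ->
  prodm (A `|` B) = prodm A + prodm B.
Proof.
by move=> mA mB AB; rewrite /prodm measureU// fineD// prodm_fin.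
Qed.

Let prodm_ge0 A : 0 <= prodm A.
Proof. exact: fine_ge0. Qed.

Let fib s k : set (borel Y) := cell s @^-1` [set k].

Let mpfib s k : measurable (p @^-1` (fib s k) : set (borel P)).
Proof. by rewrite -[X in measurable X]setTI; apply: mp => //; exact: measurable_cell. Qed.

Let mqfib s k : measurable (q @^-1` (fib s k) : set (borel Q)).
Proof. by rewrite -[X in measurable X]setTI; apply: mq => //; exact: measurable_cell. Qed.

Let block s k : set PP := (p @^-1` (fib s k)) `*` (q @^-1` (fib s k)).

Let mblock s k : measurable (block s k).
Proof. exact: measurableX. Qed.

(* The coupling attached to the partition s: independent inside each block.  A
   block of measure zero contributes 0, as division by zero gives 0. *)
Let gam (s : seq (set Y)) (A : set PP) : R :=
  \sum_(k < 2 ^ size s) prodm (A `&` block s (val k)) / fine (alpha (p @^-1` (fib s (val k)))).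

Let gamU s (A B : set PP) : measurable A -> measurable B -> A `&` B = set0 ->
  gam s (A `|` B) = gam s A + gam s B.
Proof.
move=> mA mB AB; rewrite /gam -big_split /=; apply: eq_bigr => k _.
rewrite setIUl prodmU ?mulrDl//; [exact: measurableI|exact: measurableI|].
by rewrite setIACA AB set0I.
Qed.

Let gam_ge0 s A : 0 <= gam s A.
Proof. by apply: sumr_ge0 => k _; rewrite divr_ge0// fine_ge0. Qed.

Let gam_fst s (A : set (borel P)) : measurable A ->
  gam s (A `*` setT) = fine (alpha A).
Proof.
move=> mA; rewrite /gam -(sum_cells alpha s mp mA); apply: eq_bigr => k _.
have -> : (A `*` setT) `&` block s k =
    (A `&` p @^-1` (fib s k)) `*` (q @^-1` (fib s k)) :> set PP.
  by apply/seteqP; split => [[x y] [[? _] [? ?]]|[x y] [[? ?] ?]].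
have mA' : measurable (A `&` p @^-1` (fib s k)) by exact: measurableI.
rewrite /prodm product_measure1E// fineM ?fin_num_measure//.
rewrite -[X in fine _ * X / _]/(fine (beta (q @^-1` (fib s k)))) -marginal; last exact: measurable_cell.
(* over a null cell both sides vanish *)
have [f0|f0] := eqVneq (fine (alpha (p @^-1` (fib s k)))) 0; last by rewrite mulfK.
rewrite f0 invr0 mulr0; apply/esym/eqP; rewrite eq_le fine_ge0// andbT -f0.
by apply: fine_le; rewrite ?fin_num_measure//; apply: le_measure; rewrite ?inE.
Qed.

Let gam_snd s (B : set (borel Q)) : measurable B ->
  gam s (setT `*` B) = fine (beta B).
Proof.
move=> mB; rewrite /gam -(sum_cells beta s mq mB); apply: eq_bigr => k _.
have -> : (setT `*` B) `&` block s k =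
    (p @^-1` (fib s k)) `*` (B `&` q @^-1` (fib s k)) :> set PP.
  by apply/seteqP; split => [[x y] [[? ?] [? ?]]|[x y] [? [? ?]]].
have mB' : measurable (B `&` q @^-1` (fib s k)) by exact: measurableI.
rewrite /prodm product_measure1E// fineM ?fin_num_measure//.
have [f0|f0] := eqVneq (fine (alpha (p @^-1` (fib s k)))) 0; last by rewrite mulrC mulKf.
rewrite f0 invr0 mulr0; apply/esym/eqP; rewrite eq_le fine_ge0// andbT -f0.
rewrite marginal; last exact: measurable_cell.
by apply: fine_le; rewrite ?fin_num_measure//; apply: le_measure; rewrite ?inE.
Qed.

Let gamT s : gam s setT = M.
Proof. by rewrite -setXTT gam_fst. Qed.

Let gam_le s (A : set PP) : measurable A -> gam s A <= M.
Proof. move=> mA; rewrite -(gamT s).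
by apply: (finitely_additive_mono (fun B _ => gam_ge0 s B) (@gamU s)). Qed.

Let U (A : set (P * Q)) := open A /\ measurable (A : set PP).

Let rect_open (A : set P) (B : set Q) : open A -> open B -> open (A `*` B : set (P * Q)).
Proof.
move=> oA oB; rewrite openE => -[x y] [/= Ax By]; rewrite /interior.
by exists (A, B) => //; split; exact: open_nbhs_nbhs.
Qed.

Let U_rect A B : open A -> open B -> U (A `*` B).
Proof.
move=> oA oB; split; first exact: rect_open.
by apply: measurableX; exact: open_borel.
Qed.

(* an open set need not be measurable for the product sigma-algebra, but a
   finite union of open rectangles is *)
Let U_nbhs K O : compact K -> open O -> K `<=` O ->
  exists V, [/\ U V, K `<=` V & V `<=` O].
Proof.
move=> cK oO KO.
pose D := [set AB : set P * set Q | [/\ open AB.1, open AB.2 & AB.1 `*` AB.2 `<=` O]].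
pose f (AB : set P * set Q) : set (P * Q) := AB.1 `*` AB.2.
have Df i : D i -> U (f i) by move=> [? ? _]; exact: U_rect.
move: cK; rewrite compact_cover => /(_ _ D f)[].
- by move=> i /Df[].
- move=> [x y] Kxy; have : nbhs (x, y) O by apply: open_nbhs_nbhs; split => //; exact: KO.
  move=> [[A B] /= [Ax By] AB]; exists (interior A, interior B).
    split => /=; [exact: open_interior|exact: open_interior|].
    by move=> [a b] [/= /interior_subset Aa /interior_subset Bb]; apply: AB.
  by split; rewrite /= ; exact: nbhs_singleton (nbhs_interior _).
move=> D' D'D KD'; exists (\bigcup_(i in [set` D']) f i); split => //.
- split.
    by apply: bigcup_open => i /= iD'; have [] := Df i (set_mem (D'D _ iD')).
  apply: fin_bigcup_measurable => //= i iD'.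
  by have [] := Df i (set_mem (D'D _ iD')).
- move=> x [i /= iD' fx]; have [_ _] := set_mem (D'D _ iD'); exact.
Qed.

Section limit.
Variable UF : set_system (seq (set Y)).
Hypothesis ultraUF : UltraFilter UF.
Hypothesis refUF : refinements `<=` UF.

Let L (A : set PP) : R := lim (gam s A @[s --> UF]).

Let L_cvg (A : set PP) : measurable A -> gam s A @[s --> UF] --> L A.
Proof.
move=> mA; suff : cvg (gam s A @[s --> UF]) by [].
by apply: (@ultra_bounded_cvg _ _ _ _ 0 M) => s; rewrite gam_ge0 gam_le.
Qed.

Let L_ge (A : set PP) x : measurable A -> (forall s, x <= gam s A) -> x <= L A.
Proof.
by move=> mA h; apply: limr_ge; [exact: L_cvg|exact: nearW].
Qed.

Let L_le_near (A : set PP) x : measurable A ->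
  UF [set s | gam s A <= x] -> L A <= x.
Proof. by move=> mA h; apply: limr_le; [exact: L_cvg|exact: h]. Qed.

Let L_le (A : set PP) x : measurable A -> (forall s, gam s A <= x) -> L A <= x.
Proof. by move=> mA h; apply: L_le_near => //; exact: nearW. Qed.

Let L_ge0 (A : set PP) : measurable A -> 0 <= L A.
Proof. by move=> mA; exact: L_ge. Qed.

Let L_add (A B : set PP) : measurable A -> measurable B -> A `&` B = set0 ->
  L (A `|` B) = L A + L B.
Proof.
move=> mA mB AB; apply: (cvg_lim (@Rhausdorff R)).
under eq_fun do rewrite gamU//.
by apply: cvgD; exact: L_cvg.
Qed.

Let L_const (A : set PP) x : (forall s, gam s A = x) -> L A = x.
Proof.
move=> h; apply: (cvg_lim (@Rhausdorff R)); under eq_fun do rewrite h.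
exact: cvg_cst.
Qed.

Let L_mono := finitely_additive_mono L_ge0 L_add.
Let L_subadd := finitely_additive_subadd L_ge0 L_add.

(* the marginals of L are exactly alpha and beta, whose compact sets K1 and K2
   carry nearly all the mass *)
Let L_tight (e : R) : 0 < e -> exists2 K : set (P * Q), compact K &
  forall V, U V -> K `<=` V -> M - e <= L V.
Proof.
move=> e0; have e2 : 0 < e / 2 by rewrite divr_gt0.
have [K1 [cK1 _ l1]] := radonP alpha measurableT e2.
have [K2 [cK2 _ l2]] := radonP beta measurableT e2.
exists (K1 `*` K2); first exact: compact_setX.
move=> V [oV mV] KV.
have m1 : measurable (setT `\` K1 : set (borel P)).
  by apply: measurableD => //; exact: compact_borel.
have m2 : measurable (setT `\` K2 : set (borel Q)).
  by apply: measurableD => //; exact: compact_borel.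
have mm1 : measurable ((setT `\` K1) `*` setT : set PP) by exact: measurableX.
have mm2 : measurable (setT `*` (setT `\` K2) : set PP) by exact: measurableX.
have mm : measurable ((setT `\` K1) `*` setT `|` setT `*` (setT `\` K2) : set PP).
  exact: measurableU.
have : L setT <= L V + (L ((setT `\` K1) `*` setT) + L (setT `*` (setT `\` K2))).
  apply: (@le_trans _ _ (L (V `|` ((setT `\` K1) `*` setT `|` setT `*` (setT `\` K2))))).
    apply: L_mono; [exact: measurableT|exact: measurableU|].
    move=> [x y] _; have [K1x|?] := pselect (K1 x); last by right; left.
    by have [K2y|?] := pselect (K2 y); [left; exact: KV|right; right].
  apply: le_trans (L_subadd mV mm) _; rewrite lerD2l; exact: L_subadd.
rewrite (L_const gamT) (L_const (fun s => gam_fst s m1)) (L_const (fun s => gam_snd s m2)).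
have : fine (alpha (setT `\` K1)) <= e / 2.
  by rewrite -lee_fin fineK// fin_num_measure.
have : fine (beta (setT `\` K2)) <= e / 2.
  by rewrite -lee_fin fineK// fin_num_measure.
lra.
Qed.

(* as soon as A belongs to s, no cell meets both A and B *)
Let L_off (A B : set Y) : open A -> open B -> A `&` B = set0 ->
  L ((p @^-1` A) `*` (q @^-1` B)) <= 0.
Proof.
move=> oA oB AB.
have mpA : measurable (p @^-1` A : set (borel P)).
  by apply: open_borel; move/continuousP: cp; exact.
have mqB : measurable (q @^-1` B : set (borel Q)).
  by apply: open_borel; move/continuousP: cq; exact.
apply: L_le_near; first exact: measurableX.
apply: refUF; exists [:: A] => s As /=; rewrite /gam big1// => k _.
rewrite (_ : _ `&` _ = set0) /prodm ?measure0 ?mul0r//.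
rewrite -subset0 => -[x y] [[/= Ax By] [/= xk yk]].
have : (A `&` B) (q y).
  split => //; apply: (@cell_separates _ s _ _ _ oA _ _ Ax); last by rewrite xk yk.
  by apply: As; rewrite mem_head.
by rewrite AB.
Qed.

Let coupling : exists rho : radon_measure R (P * Q)%type,
  rho setT = M%:E /\ forall V, U V -> (rho V <= (L V)%:E)%E.
Proof.
apply: (radon_of_content hW) L_tight.
- by move=> A [].
- by move=> A B [oA mA] [oB mB]; split; [exact: openU|exact: measurableU].
- exact: U_nbhs.
- by move=> A [_ mA]; exact: L_ge0.
- by move=> A [_ mA]; apply: L_le => // s; exact: gam_le.
- by move=> A B [_ mA] [_ mB]; exact: L_mono.
- by move=> A B [_ mA] [_ mB]; exact: L_subadd.
- by move=> A B [_ mA] [_ mB] AB; rewrite L_add.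
Qed.

(** The set where p x.1 and q x.2 differ is open and covered by open boxes of
    measure zero; a compact subset meets finitely many of them, so it is null,
    and inner regularity makes the whole set null. *)
Lemma glue_limit : exists rho : radon_measure R (P * Q)%type,
  [/\ forall A : set (borel P), measurable A -> rho (fst @^-1` A) = alpha A,
      forall B : set (borel Q), measurable B -> rho (snd @^-1` B) = beta B &
      {ae rho, forall x, p x.1 = q x.2}].
Proof.
have [rho [rhoT rhoL]] := coupling.
have aT : alpha setT = M%:E by rewrite /M fineK// fin_num_measure.
exists rho; split.
- move=> A mA; apply: pushforward_radon_eq => //.
  + by move=> x; exact: cvg_fst.
  + by rewrite aT.
  + move=> V oV; have -> : fst @^-1` V = V `*` setT :> set (P * Q).
      by apply/seteqP; split => [x|x []].
    apply: le_trans (rhoL _ (U_rect oV openT)) _.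
    rewrite (L_const (fun s => gam_fst s (open_borel oV))) fineK//.
    by rewrite fin_num_measure//; exact: open_borel.
- move=> A mA; apply: pushforward_radon_eq => //.
  + by move=> x; exact: cvg_snd.
  + by rewrite betaT aT.
  + move=> V oV; have -> : snd @^-1` V = setT `*` V :> set (P * Q).
      by apply/seteqP; split => [x|x []].
    apply: le_trans (rhoL _ (U_rect openT oV)) _.
    rewrite (L_const (fun s => gam_snd s (open_borel oV))) fineK//.
    by rewrite fin_num_measure//; exact: open_borel.
pose D := [set AB : set Y * set Y | [/\ open AB.1, open AB.2 & AB.1 `&` AB.2 = set0]].
pose f (AB : set Y * set Y) : set (P * Q) := (p @^-1` AB.1) `*` (q @^-1` AB.2).
have Uf i : D i -> U (f i).
  move=> [oA oB _]; apply: U_rect; [move/continuousP: cp|move/continuousP: cq]; exact.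
have f0 i : D i -> rho (f i) = 0%E.
  move=> Di; apply/eqP; rewrite eq_le measure_ge0 andbT.
  apply: le_trans (rhoL _ (Uf _ Di)) _; rewrite lee_fin.
  by case: Di => ? ? ?; exact: L_off.
have Nf : [set x | p x.1 <> q x.2] `<=` cover D f.
  move=> [x y] /= /eqP xy; move: hY; rewrite open_hausdorff => /(_ _ _ xy).
  move=> [[A B] /=]; rewrite !inE => -[Ax By] [oA oB AB].
  by exists (A, B) => //; split => //; exact/eqP.
have Df i : D i -> f i `<=` [set x | p x.1 <> q x.2].
  move=> [_ _ AB] [x y] [/= Ax By] xy.
  have : (i.1 `&` i.2) (q y) by split => //; rewrite -xy.
  by rewrite AB.
have NE : [set x | p x.1 <> q x.2] = \bigcup_(i in D) f i.
  by apply/seteqP; split => // x [i Di /(Df _ Di)].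
have mN : measurable ([set x | p x.1 <> q x.2] : set (borel (P * Q)%type)).
  by rewrite NE; apply: open_borel; apply: bigcup_open => i /Uf[].
exists [set x | p x.1 <> q x.2]; split => //.
apply/eqP; rewrite eq_le measure_ge0 andbT; apply/lee_addgt0Pr => e e0.
have [K [cK KN lK]] := radonP rho mN e0.
have mK : measurable (K : set (borel (P * Q)%type)) by exact: compact_borel.
rewrite add0e; apply: le_trans lK.
rewrite -[X in (rho X <= _)%E](setDUK KN) measureU ?setDIK//; last exact: measurableD.
suff K0 : rho K = 0%E by rewrite [X in (X + _ <= _)%E]K0 add0e.
move: cK; rewrite compact_cover => /(_ _ D f)[].
- by move=> i /Uf[].
- exact: subset_trans Nf.
move=> D' D'D KD'; apply/eqP; rewrite eq_le measure_ge0 andbT.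
have [mD0 <-] : measurable (\bigcup_(i in [set` D']) f i : set (borel (P * Q)%type)) /\
    rho (\bigcup_(i in [set` D']) f i) = 0%E.
  rewrite bigcup_fset big_seq; elim/big_ind: _ => //.
  - move=> A B [mA A0] [mB B0]; split; first exact: measurableU.
    by apply/eqP; rewrite eq_le measure_ge0 andbT -(adde0 0%E) -{1}A0 -B0; exact: measureU2.
  - move=> i /D'D /set_mem Di; split; last exact: f0.
    by apply: open_borel; have [] := Uf _ Di.
by apply: le_measure; rewrite ?inE.
Qed.

End limit.

Lemma glue : exists rho : radon_measure R (P * Q)%type,
  [/\ forall A : set (borel P), measurable A -> rho (fst @^-1` A) = alpha A,
      forall B : set (borel Q), measurable B -> rho (snd @^-1` B) = beta B &
      {ae rho, forall x, p x.1 = q x.2}].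
Proof.
have [UF [ultraUF sub]] := ultraFilterLemma (@refinements_filter Y).
exact: glue_limit ultraUF sub.
Qed.

End glue.

(** * Topology of the cone *)

Lemma continuous_fst (T T' : topologicalType) : continuous (@fst T T').
Proof. by move=> x; exact: cvg_fst. Qed.

Lemma continuous_snd (T T' : topologicalType) : continuous (@snd T T').
Proof. by move=> x; exact: cvg_snd. Qed.

Section cone_topology.
Context {R : realType} {X : ptopologicalType}.
Variable xbar : X.
Local Notation C := (cone R X).
Implicit Types c : C.

Lemma cone_radius_ge0 c : 0 <= cone_radius c.
Proof. by rewrite /cone_radius. Qed.

Lemma cone_radius_le0 c : cone_radius c <= 0 -> cone_radius c = 0.
Proof. by move=> c0; apply/eqP; rewrite eq_le c0 cone_radius_ge0. Qed.

Lemma cone_baseE c : 0 < cone_radius c -> cone_base xbar c = (repr c).1.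
Proof. by rewrite /cone_base => ->. Qed.

Lemma nbhs_cone_pt (x : X) (r : {nonneg R}) (A : set C) : 0 < r%:num ->
  nbhs (cone_pt x r) A = nbhs (x, r%:num)
    [set q : X * R | forall s : {nonneg R}, s%:num = q.2 -> A (cone_pt q.1 s)].
Proof.
move=> r0; rewrite [LHS]/nbhs /= /cone_nbhs cone_radius_pt r0.
suff -> : (repr (cone_pt x r)).1 = x by [].
by have := cone_base_pt point x r0; rewrite /cone_base cone_radius_pt r0.
Qed.

Lemma nbhs_cone_vertex c (A : set C) : cone_radius c = 0 ->
  nbhs c A = exists2 e : R, 0 < e & [set c' : C | cone_radius c' < e] `<=` A.
Proof. by move=> c0; rewrite [LHS]/nbhs /= /cone_nbhs c0 ltxx. Qed.

Lemma continuous_cone_radius : continuous (@cone_radius R X).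
Proof.
move=> c A /= cA; have [r0|r0] := ltP 0 (cone_radius c).
  change (nbhs c (@cone_radius R X @^-1` A)).
  rewrite -[c]cone_ptE nbhs_cone_pt//=.
  exists (setT, A) => /=; first by split => //; exact: filterT.
  by move=> [x t] [_ /= At] s st; rewrite /= cone_radius_pt st.
have {}r0 := cone_radius_le0 r0.
change (nbhs c (@cone_radius R X @^-1` A)).
rewrite nbhs_cone_vertex//; rewrite r0 in cA.
have [e /= e0 eA] := cA; exists e => // c' /= c'e; apply: eA => /=.
by rewrite sub0r normrN ger0_norm// cone_radius_ge0.
Qed.

Lemma measurable_radius (T : ptopologicalType) (pr : T -> C) : continuous pr ->
  measurable_fun setT ((fun p => cone_radius (pr p)) : borel T -> R).
Proof.
move=> cpr; apply: continuous_borelR => p.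
apply: continuous_comp; [exact: cpr|exact: continuous_cone_radius].
Qed.

Lemma continuous_cone_base c : 0 < cone_radius c ->
  {for c, continuous (cone_base xbar)}.
Proof.
move=> r0 A; rewrite /= cone_baseE// => cA.
change (nbhs c (cone_base xbar @^-1` A)).
rewrite -[c]cone_ptE nbhs_cone_pt//=.
exists (A, [set t | 0 < t]) => /=; first by split => //; exact: lt_nbhsr.
by move=> [x t] [/= Ax t0] s st; rewrite /= cone_base_pt ?st.
Qed.

Lemma continuous_cone_pt :
  continuous (fun q : X * R => cone_pt q.1 (NngNum (normr_ge0 q.2)) : C).
Proof.
move=> [x t] A /=.
have [->|t0] := eqVneq t 0.
  rewrite nbhs_cone_vertex; last by rewrite cone_radius_pt /= normr0.
  move=> [e e0 eA]; exists (setT, ball 0 e) => /=.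
    by split; [exact: filterT|exact: nbhsx_ballx].
  move=> [y s] [_ /= se]; apply: eA => /=; rewrite cone_radius_pt /=.
  by move: se; rewrite /ball /= sub0r normrN.
rewrite nbhs_cone_pt/= ?normr_gt0//.
move=> [[U V] /= [xU tV] UV]; exists (U, [set s | V `|s|]) => /=.
  by split => //; apply: (@norm_continuous _ R^o t).
by move=> [y s] [/= Uy Vs]; exact: (UV (y, `|s|)).
Qed.

Lemma cone_pt_inj_radius0 c c' : cone_radius c = 0 -> cone_radius c' = 0 -> c = c'.
Proof.
move=> c0 c0'; rewrite -(cone_ptE c) -(cone_ptE c'); apply/eqmodP.
by rewrite /= /cone_rel /= -!/(cone_radius _) c0 c0' eqxx orbT.
Qed.

Lemma cone_eq c c' : cone_radius c = cone_radius c' ->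
  cone_base xbar c = cone_base xbar c' -> c = c'.
Proof.
move=> rr; have [r0|r0] := ltP 0 (cone_radius c).
  rewrite !cone_baseE -?rr// => xx.
  rewrite -(cone_ptE c) -(cone_ptE c') xx; congr cone_pt.
  exact/val_inj.
have {}r0 := cone_radius_le0 r0.
by move=> _; apply: cone_pt_inj_radius0 => //; rewrite -rr.
Qed.

Lemma hausdorff_cone : hausdorff_space X -> hausdorff_space C.
Proof.
move=> hX c c' cc'.
have rr : cone_radius c = cone_radius c'.
  apply: (@Rhausdorff R) => A B /continuous_cone_radius cA /continuous_cone_radius cB.
  by have [z [? ?]] := cc' _ _ cA cB; exists (cone_radius z).
apply: cone_eq => //; have [r0|r0] := ltP 0 (cone_radius c); last first.
  by rewrite /cone_base -rr ltNge r0.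
have r0' : 0 < cone_radius c' by rewrite -rr.
apply: hX => A B /(continuous_cone_base r0) cA /(continuous_cone_base r0') cB.
by have [z [? ?]] := cc' _ _ cA cB; exists (cone_base xbar z).
Qed.

Lemma open_cone_pos : open [set c : C | 0 < cone_radius c].
Proof.
have /continuousP := continuous_cone_radius.
move=> /(_ [set t | 0 < t]); exact.
Qed.

(** Away from the vertex the base point is continuous; on the remaining closed
    set it is constant. *)
Lemma measurable_cone_base :
  measurable_fun setT (cone_base xbar : borel C -> borel X).
Proof.
apply: (@measurability _ _ (borel C) (borel X) setT (cone_base xbar) (@open X)) => //.
move=> _ [A oA <-]; rewrite setTI.
have mpos : measurable ([set c : C | 0 < cone_radius c] : set (borel C)).
  by apply: open_borel; exact: open_cone_pos.
have -> : cone_base xbar @^-1` A =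
    ([set c : C | 0 < cone_radius c] `&` cone_base xbar @^-1` A) `|`
    (~` [set c : C | 0 < cone_radius c] `&` [set c | A xbar]).
  apply/seteqP; split => c /=; rewrite /cone_base; case: ifPn => //.
  - by left.
  - by move=> /negP; right.
  - by move=> cp [[]|[]//].
  - by move=> cp [[]//|[]].
apply: measurableU.
  apply: open_borel; rewrite openE => c [/= r0 Ac]; apply: filterI.
    by apply: open_nbhs_nbhs; split => //; exact: open_cone_pos.
  by apply: continuous_cone_base => //; exact: open_nbhs_nbhs.
apply: measurableI; first exact: measurableC.
have [Ax|nAx] := pselect (A xbar).
  by rewrite (_ : [set _ | _] = setT)//; apply/seteqP; split.
by rewrite (_ : [set _ | _] = set0)//; apply/seteqP; split.
Qed.

End cone_topology.

(** * The squared cone distance *)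

Section planar.
Context {R : realType}.
Implicit Types a b c r eta : R.

(** Take p2 = (r2, 0) in the plane, p1 at distance r1 from the origin and angle
    a, p3 at distance r3 and angle - b.  By the law of cosines the statement
    bounds |p1 - p3|^2 by (1 + eta) |p1 - p2|^2 + (1 + 1/eta) |p2 - p3|^2. *)
Lemma planar_triangle a b r1 r2 r3 eta : 0 < eta ->
  r1 ^+ 2 + r3 ^+ 2 - 2 * r1 * r3 * cos (a + b) <=
  (1 + eta) * (r1 ^+ 2 + r2 ^+ 2 - 2 * r1 * r2 * cos a) +
  (1 + eta^-1) * (r2 ^+ 2 + r3 ^+ 2 - 2 * r2 * r3 * cos b).
Proof.
move=> eta0; rewrite cosD -subr_ge0.
have ha := cos2Dsin2 a; have hb := cos2Dsin2 b.
set ca := cos a in ha *; set sa := sin a in ha *.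
set cb := cos b in hb *; set sb := sin b in hb *.
(* the difference is |eta (p1 - p2) - (p2 - p3)|^2 / eta, up to multiples of
   1 - (cos^2 + sin^2) *)
have -> : (1 + eta) * (r1 ^+ 2 + r2 ^+ 2 - 2 * r1 * r2 * ca) +
  (1 + eta^-1) * (r2 ^+ 2 + r3 ^+ 2 - 2 * r2 * r3 * cb) -
  (r1 ^+ 2 + r3 ^+ 2 - 2 * r1 * r3 * (ca * cb - sa * sb)) =
  ((eta * (r1 * ca - r2) - (r2 - r3 * cb)) ^+ 2 +
   (eta * (r1 * sa) - r3 * sb) ^+ 2) / eta +
  (eta * r1 ^+ 2 * (1 - (ca ^+ 2 + sa ^+ 2)) +
   eta^-1 * r3 ^+ 2 * (1 - (cb ^+ 2 + sb ^+ 2))).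
  by field; exact: lt0r_neq0.
rewrite ha hb subrr !mulr0 !addr0.
by rewrite divr_ge0// ?addr_ge0 ?sqr_ge0// ltW.
Qed.

(** The angle c between the first and third points may be less than a + b, and
    a + b may exceed pi, so that the planar configuration does not exist as
    such.  Lowering b to at most pi - a lowers the right-hand side and keeps
    c <= a + b <= pi, where the cosine is decreasing. *)
Lemma cos_law_triangle a b c r1 r2 r3 eta : 0 < eta ->
  0 <= r1 -> 0 <= r2 -> 0 <= r3 ->
  0 <= a <= pi -> 0 <= b <= pi -> 0 <= c <= pi -> c <= a + b ->
  r1 ^+ 2 + r3 ^+ 2 - 2 * r1 * r3 * cos c <=
  (1 + eta) * (r1 ^+ 2 + r2 ^+ 2 - 2 * r1 * r2 * cos a) +
  (1 + eta^-1) * (r2 ^+ 2 + r3 ^+ 2 - 2 * r2 * r3 * cos b).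
Proof.
move=> eta0 r10 r20 r30 /andP[a0 api] /andP[b0 bpi] /andP[c0 cpi] cab.
pose b' := Num.min b (pi - a).
have b'b : b' <= b by rewrite /b' ge_min lexx.
have b'a : a + b' <= pi by rewrite -lerBrDl /b' ge_min lexx orbT.
have b'0 : 0 <= b' by rewrite /b' le_min b0 subr_ge0.
have cb' : c <= a + b'.
  by rewrite /b' addr_minr le_min cab /= addrC subrK.
have cosab : cos (a + b') <= cos c.
  by rewrite leNgt ltr_cos ?in_itv//= ?c0 ?cpi ?b'a ?andbT ?addr_ge0// -leNgt.
have cosb : cos b <= cos b'.
  by rewrite leNgt ltr_cos ?in_itv//= ?b0 ?bpi ?b'0//= ?(le_trans b'b)// -leNgt.
have := planar_triangle a b' r1 r2 r3 eta0.
have h1 : r1 * r3 * cos (a + b') <= r1 * r3 * cos c.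
  by rewrite ler_wpM2l// mulr_ge0.
have h2 : (1 + eta^-1) * (r2 * r3 * cos b) <= (1 + eta^-1) * (r2 * r3 * cos b').
  by rewrite ler_wpM2l// ?ler_wpM2l ?mulr_ge0// addr_ge0// invr_ge0 ltW.
move: h1 h2; lra.
Qed.

Lemma sqr_young r s eta : 0 < eta ->
  (r + s) ^+ 2 <= (1 + eta) * r ^+ 2 + (1 + eta^-1) * s ^+ 2.
Proof.
move=> eta0; rewrite -subr_ge0.
have -> : (1 + eta) * r ^+ 2 + (1 + eta^-1) * s ^+ 2 - (r + s) ^+ 2 =
    (eta * r - s) ^+ 2 / eta by field; exact: lt0r_neq0.
by rewrite divr_ge0 ?sqr_ge0// ltW.
Qed.

End planar.

Section cone_dist2.
Context {R : realType} {X : ptopologicalType}.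
Variable d : X -> X -> \bar R.
Hypothesis dX : is_extended_distance eq d.
Hypothesis d_lsc : lower_semicontinuous (fun p : X * X => d p.1 p.2).
Local Notation C := (cone R X).
Implicit Types c : C.

Definition truncated_angle (x y : X) : R := fine (Order.min (d x y) pi%:E).

Lemma truncated_angleE x y : (truncated_angle x y)%:E = Order.min (d x y) pi%:E.
Proof.
rewrite /truncated_angle fineK// ge0_fin_numE.
  by rewrite gt_min ltry orbT.
by rewrite le_min (Defs.edist_ge0 dX)//= lee_fin pi_ge0.
Qed.

Lemma truncated_angle_bounds x y : 0 <= truncated_angle x y <= pi.
Proof.
by rewrite -!lee_fin truncated_angleE le_min (Defs.edist_ge0 dX)//= lee_fin pi_ge0/= ge_min lexx orbT.
Qed.

Lemma truncated_angle_sym x y : truncated_angle x y = truncated_angle y x.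
Proof. by rewrite /truncated_angle (Defs.edist_sym dX). Qed.

Lemma truncated_angle_triangle x y z :
  truncated_angle x z <= truncated_angle x y + truncated_angle y z.
Proof.
have /andP[a0 _] := truncated_angle_bounds x y.
have /andP[b0 _] := truncated_angle_bounds y z.
rewrite -lee_fin EFinD !truncated_angleE.
have [h1|h1] := leP (d x y) pi%:E; last first.
  rewrite ge_min; apply/orP; right; apply: leeDl.
  by rewrite le_min (Defs.edist_ge0 dX)//= lee_fin pi_ge0.
have [h2|h2] := leP (d y z) pi%:E; last first.
  by rewrite ge_min; apply/orP; right; apply: leeDr; exact: Defs.edist_ge0 dX _ _.
by rewrite ge_min (Defs.edist_triangle dX).
Qed.

Lemma cone_dist2E xbar c1 c2 : cone_dist2 d c1 c2 =
  cone_radius c1 ^+ 2 + cone_radius c2 ^+ 2 - 2 * cone_radius c1 * cone_radius c2 *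
    cos (truncated_angle (cone_base xbar c1) (cone_base xbar c2)).
Proof.
rewrite /cone_dist2 /truncated_angle.
have [r1|r1] := ltP 0 (cone_radius c1); last first.
  by rewrite (cone_radius_le0 r1) !(mulr0, mul0r).
have [r2|r2] := ltP 0 (cone_radius c2); last first.
  by rewrite (cone_radius_le0 r2) !(mulr0, mul0r).
by rewrite !(cone_baseE xbar).
Qed.

Lemma cone_dist2_sym c1 c2 : cone_dist2 d c1 c2 = cone_dist2 d c2 c1.
Proof. by rewrite !(cone_dist2E point) truncated_angle_sym; ring. Qed.

Lemma cone_dist2_ge_radius c1 c2 :
  (cone_radius c1 - cone_radius c2) ^+ 2 <= cone_dist2 d c1 c2.
Proof.
rewrite (cone_dist2E point) -subr_ge0.
set t := truncated_angle _ _; set r := cone_radius c1; set s := cone_radius c2.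
have -> : r ^+ 2 + s ^+ 2 - 2 * r * s * cos t - (r - s) ^+ 2 =
  2 * (r * s * (1 - cos t)) by ring.
by rewrite mulr_ge0// mulr_ge0 ?mulr_ge0 ?cone_radius_ge0// subr_ge0 cos_le1.
Qed.

Lemma cone_dist2_ge0 c1 c2 : 0 <= cone_dist2 d c1 c2.
Proof. exact: le_trans (sqr_ge0 _) (cone_dist2_ge_radius c1 c2). Qed.

Lemma cone_dist2_triangle c1 c2 c3 eta : 0 < eta ->
  cone_dist2 d c1 c3 <= (1 + eta) * cone_dist2 d c1 c2 +
    (1 + eta^-1) * cone_dist2 d c2 c3.
Proof.
move=> eta0; rewrite !(cone_dist2E point).
by apply: cos_law_triangle; rewrite ?cone_radius_ge0 ?truncated_angle_bounds//
  truncated_angle_triangle.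
Qed.

Lemma cone_radius_le_dist2 c1 c2 eta : 0 < eta ->
  cone_radius c1 ^+ 2 <= (1 + eta) * cone_radius c2 ^+ 2 +
    (1 + eta^-1) * cone_dist2 d c1 c2.
Proof.
move=> eta0; rewrite -[X in X ^+ 2 <= _](subrK (cone_radius c2)) addrC.
apply: le_trans (sqr_young _ _ eta0) _; rewrite lerD2l ler_wpM2l//.
  by rewrite addr_ge0// invr_ge0 ltW.
exact: cone_dist2_ge_radius.
Qed.

(** The squared distance from a point of norm r to a ray at an angle of cosine
    at most k is at least (1 - k^2) r^2; this is the minimum over s of
    r^2 + s^2 - 2 r s k, attained at s = k r. *)
Lemma cone_dist2_ge_angle xbar c1 c2 k :
  cos (truncated_angle (cone_base xbar c1) (cone_base xbar c2)) <= k ->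
  (1 - k ^+ 2) * cone_radius c1 ^+ 2 <= cone_dist2 d c1 c2.
Proof.
move=> hk; rewrite (cone_dist2E xbar).
set t := truncated_angle _ _ in hk *; set r := cone_radius c1; set s := cone_radius c2.
have h : r * s * cos t <= r * s * k by rewrite ler_wpM2l// mulr_ge0 ?cone_radius_ge0.
have := sqr_ge0 (s - k * r).
have -> : (s - k * r) ^+ 2 = s ^+ 2 - 2 * (r * s * k) + k ^+ 2 * r ^+ 2 by ring.
move: h; lra.
Qed.

Lemma cone_dist2_vertex c1 c2 : cone_radius c2 = 0 ->
  cone_dist2 d c1 c2 = cone_radius c1 ^+ 2.
Proof. by move=> c0; rewrite (cone_dist2E point) c0; ring. Qed.

Lemma cone_dist2_refl c : cone_dist2 d c c = 0.
Proof.
rewrite (cone_dist2E point) /truncated_angle (Defs.edist_eq0 dX _ _).2//.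
rewrite min_l ?lee_fin ?pi_ge0//= cos0; ring.
Qed.

Let D (p : C * C) := d (cone_base point p.1) (cone_base point p.2).

Let pos := [set p : C * C | 0 < cone_radius p.1 /\ 0 < cone_radius p.2].

Let open_pos : open pos.
Proof.
rewrite openE => -[c1 c2] [/= r1 r2].
exists ([set c | 0 < cone_radius c], [set c | 0 < cone_radius c]) => //=.
by split; apply: open_nbhs_nbhs; split => //; exact: open_cone_pos.
Qed.

(* off the vertex the base points depend continuously on the cone points, so
   D inherits the lower semicontinuity of d *)
Let measurable_D : measurable_fun (pos : set (borel (C * C)%type))
  (D : borel (C * C)%type -> \bar R).
Proof.
move=> _; apply: (measurability _ (ErealGenOInfty.measurableE R)) => //; last exact: open_borel.
move=> _ [_ [a ->] <-]; rewrite preimage_itvoy; apply: open_borel.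
rewrite openE => -[c1 c2] [[/= r1 r2] aD].
have [V nV VD] := @d_lsc (_, _) _ aD.
apply: filterI; first by apply: open_nbhs_nbhs; split.
have [[A B] /= [cA cB] AB] := nV.
exists (cone_base point @^-1` A, cone_base point @^-1` B).
  by split; exact: continuous_cone_base.
by move=> [p1 p2] [/= Ap Bp]; apply: VD (AB (_, _) _).
Qed.

(** When one of the points is the vertex the cosine term drops out, so the lack
    of continuity of the base point there is harmless. *)
Lemma measurable_cone_dist2 : measurable_fun setT
  ((fun p => cone_dist2 d p.1 p.2) : borel (C * C)%type -> R).
Proof.
have mpos : measurable (pos : set (borel (C * C)%type)) by exact: open_borel.
have m1 := measurable_radius (@continuous_fst C C).
have m2 := measurable_radius (@continuous_snd C C).
have mr : measurable_fun setT
    ((fun p => cone_radius p.1 ^+ 2 + cone_radius p.2 ^+ 2) : borel (C * C)%type -> R).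
  by apply: measurable_funD; exact: measurable_funX.
rewrite -(setUv pos); apply/(measurable_funU _ mpos (measurableC mpos)); split.
  under eq_fun do rewrite (cone_dist2E point).
  apply: measurable_funB; first exact: measurable_funTS mr.
  apply: measurable_funM.
    apply: measurable_funTS; apply: measurable_funM => //.
    exact: measurable_funM.
  have mcos : measurable_fun setT (@cos R).
    by apply: continuous_measurable_fun; exact: continuous_cos.
  apply: (measurableT_comp mcos); apply: measurableT_comp => //.
  exact: measurable_mine.
apply: (@eq_measurable_fun _ _ (borel (C * C)%type) R (~` pos) _ _ _
  (measurable_funTS mr)) => p; rewrite inE => /not_andP h; apply/esym.
rewrite (cone_dist2E point) -[RHS]subr0; congr (_ - _).
by case: h => /negP; rewrite -leNgt => /cone_radius_le0 ->; rewrite !(mulr0, mul0r).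
Qed.

End cone_dist2.

(** * Homogeneous marginals of plans *)

Section radon_image.
Context {R : realType} {T T' : ptopologicalType}.
Hypothesis hT : hausdorff_space T.
Variable rho : radon_measure R T.

Lemma radon_integral_cst_fin (k : R) : 0 <= k -> (\int[rho]_x k%:E < +oo)%E.
Proof.
move=> k0; rewrite integral_cst// -ge0_fin_numE.
  by rewrite fin_numM// fin_num_measure.
by rewrite mule_ge0.
Qed.

Lemma radon_image (f : T -> T') : hausdorff_space T' -> continuous f ->
  exists nu : radon_measure R T', forall g : borel T' -> \bar R,
  measurable_fun setT g -> (forall y, (0 <= g y)%E) ->
  (\int[nu]_y g y = \int[rho]_x g (f x))%E.
Proof.
move=> hT' cf; have [|||||nu nuE] := @radon_push R T T' hT hT' rho setT (cst 1) f.
- exact: measurableT.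
- by [].
- exact: measurable_cst.
- exact: radon_integral_cst_fin.
- exact: in_continuous_within.
exists nu => g mg g0; rewrite nuE//; apply: eq_integral => x _.
by rewrite mul1e.
Qed.

Lemma radon_restriction (D : set T) : measurable (D : set (borel T)) ->
  exists nu : radon_measure R T, forall g : borel T -> \bar R,
  measurable_fun setT g -> (forall y, (0 <= g y)%E) ->
  (\int[nu]_y g y = \int[rho]_(x in D) g x)%E.
Proof.
move=> mD; have [||||nu nuE] := @radon_push R T T hT hT rho D (cst 1) id mD.
- by [].
- exact: measurable_cst.
- change ((\int[rho]_(x in D) (cst 1%:E x)) < +oo)%E; rewrite integral_cst// mul1e -ge0_fin_numE//.
  by rewrite fin_num_measure.
- by apply: in_continuous_within => x _; exact: cvg_id.
exists nu => g mg g0; rewrite nuE//; apply: eq_integral => x _.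
by rewrite mul1e.
Qed.

Lemma integral_of_image (nu : {measure set (borel T') -> \bar R}) (f : T -> T') :
  continuous f ->
  (forall A : set (borel T'), measurable A -> rho (f @^-1` A) = nu A) ->
  forall g : borel T' -> \bar R,
  measurable_fun setT g -> (forall y, (0 <= g y)%E) ->
  (\int[nu]_y g y = \int[rho]_x g (f x))%E.
Proof.
move=> cf nuE g mg g0.
rewrite (@ge0_integral_change_of_variables _ _ (borel T) (borel T') R rho nu
  setT measurableT (cst 1) f _ _ (continuous_borel cf) _ _ mg g0)//.
- by apply: eq_integral => x _; rewrite mul1e.
- move=> B mB; rewrite setTI -nuE//.
  rewrite -[RHS]/(\int[rho]_(x in f @^-1` B) (cst 1%:E x))%E integral_cst ?mul1e//.
  by rewrite -[X in measurable X]setTI; exact: (continuous_borel cf).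
Qed.

End radon_image.

Section plans.
Context {R : realType} {X : ptopologicalType}.
Variable xbar : X.
Hypothesis hX : hausdorff_space X.
Local Notation C := (cone R X).
Local Notation CC := (cone R X * cone R X)%type.

Lemma hausdorff_coneX : hausdorff_space CC.
Proof. by apply: hausdorff_prod; exact: hausdorff_cone. Qed.

Definition hom_integrand (pr : CC -> C) (g : X -> \bar R) (p : CC) : \bar R :=
  ((cone_radius (pr p) ^+ 2)%:E * g (cone_base xbar (pr p)))%E.

Lemma hom_integrand_ge0 pr g p : (forall x, (0 <= g x)%E) ->
  (0 <= hom_integrand pr g p)%E.
Proof. by move=> g0; rewrite mule_ge0// lee_fin sqr_ge0. Qed.

Lemma measurable_base (T : ptopologicalType) (pr : T -> C) : continuous pr ->
  measurable_fun setT ((fun p => cone_base xbar (pr p)) : borel T -> borel X).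
Proof.
move=> cpr; apply: (@measurableT_comp _ _ _ _ _ _ (cone_base xbar : borel C -> borel X)).
  exact: measurable_cone_base.
exact: continuous_borel.
Qed.

Lemma measurable_hom_integrand pr (g : borel X -> \bar R) : continuous pr ->
  measurable_fun setT g ->
  measurable_fun setT (hom_integrand pr g : borel CC -> \bar R).
Proof.
move=> cpr mg; apply: emeasurable_funM.
  by apply/measurable_EFinP/measurable_funX; exact: measurable_radius.
exact: (measurableT_comp mg (measurable_base cpr)).
Qed.

(** The integrated form of an equality of homogeneous marginals: it is the one
    that passes through images, restrictions and sums of plans. *)
Definition has_marginal (pr : CC -> C) (alpha : radon_measure R CC)
    (mu : radon_measure R X) : Prop :=
  forall g : borel X -> \bar R, measurable_fun setT g ->
    (forall x, (0 <= g x)%E) ->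
    (\int[mu]_x g x = \int[alpha]_p hom_integrand pr g p)%E.

Lemma has_marginalP pr alpha mu : continuous pr ->
  has_marginal pr alpha mu <->
  forall B : set (borel X), measurable B ->
    homogeneous_marginal xbar pr alpha B = mu B.
Proof.
move=> cpr; have mbase := measurable_base cpr.
split=> [h B mB|h g mg g0].
  have mI : measurable_fun setT (fun x : borel X => (\1_B x)%:E : \bar R).
    by apply/measurable_EFinP; exact: measurable_indic.
  have I0 (x : borel X) : (0 <= (\1_B x)%:E :> \bar R)%E by rewrite lee_fin.
  have := h _ mI I0; rewrite integral_indic// setIT => ->.
  rewrite /homogeneous_marginal /pushforward integral_mkcond.
  apply: eq_integral => p _; rewrite patchE /hom_integrand indicE.
  have -> : (p \in (cone_base xbar \o pr) @^-1` B) = (cone_base xbar (pr p) \in B).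
    by apply/idP/idP; rewrite !inE.
  by case: ifPn; rewrite ?mule1 ?mule0.
apply: (@ge0_integral_change_of_variables _ _ (borel CC) (borel X) R alpha mu
  setT measurableT (fun p => cone_radius (pr p) ^+ 2)
  (fun p => cone_base xbar (pr p))) => //.
- by move=> x _; exact: sqr_ge0.
- by apply: measurable_funX; exact: measurable_radius.
- by move=> B mB; rewrite setTI; exact: esym (h B mB).
Qed.

Lemma marginal_mass pr alpha mu : has_marginal pr alpha mu ->
  (\int[alpha]_p (cone_radius (pr p) ^+ 2)%:E = mu setT)%E.
Proof.
move=> h; have := h (cst 1%E) (measurable_cst _) (fun _ => lee01).
rewrite integral_cst// mul1e => ->; apply: eq_integral => p _.
by rewrite /hom_integrand mule1.
Qed.

(** By [marginal_mass] the squared radii integrate to the total masses of mu1 and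
    mu2, which are finite. *)
Lemma HK_admissibleP mu1 mu2 alpha : HK_admissible xbar mu1 mu2 alpha <->
  has_marginal fst alpha mu1 /\ has_marginal snd alpha mu2.
Proof.
have cf := @continuous_fst C C; have cs := @continuous_snd C C.
split=> [[_ /(has_marginalP _ _ cf) h1 /(has_marginalP _ _ cs) h2]//|[h1 h2]].
split; [|exact: (has_marginalP _ _ cf).1|exact: (has_marginalP _ _ cs).1].
under eq_integral do rewrite EFinD.
rewrite ge0_integralD//.
- rewrite (marginal_mass h1) (marginal_mass h2) -ge0_fin_numE ?adde_ge0//.
  by rewrite fin_numD !fin_num_measure.
- by move=> p _; rewrite lee_fin sqr_ge0.
- by apply/measurable_EFinP/measurable_funX; exact: measurable_radius.
- by move=> p _; rewrite lee_fin sqr_ge0.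
- by apply/measurable_EFinP/measurable_funX; exact: measurable_radius.
Qed.

End plans.

(** * Elementary plans *)

Section elementary_plans.
Context {R : realType} {X : ptopologicalType}.
Variables (d : X -> X -> \bar R) (xbar : X).
Hypothesis hX : is_extended_metric_topological d.
Local Notation C := (cone R X).
Local Notation CC := (cone R X * cone R X)%type.
(* the radius is |r|, which makes pt total and continuous in r *)
Local Notation pt x r := (cone_pt x (NngNum (normr_ge0 r)) : C).
Local Notation has_marginal := (has_marginal xbar).

Let hT : hausdorff_space X. Proof. exact: emt_hausdorff hX. Qed.
Let dX : is_extended_distance eq d. Proof. exact: emt_distance hX. Qed.
Let hCC : hausdorff_space CC. Proof. exact: hausdorff_coneX. Qed.

Lemma measurable_cost : measurable_fun setT
  ((fun p => (cone_dist2 d p.1 p.2)%:E) : borel CC -> \bar R).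
Proof.
by apply/measurable_EFinP; exact: (measurable_cone_dist2 (emt_lsc hX)).
Qed.

Lemma cost_ge0 (p : CC) : (0 <= (cone_dist2 d p.1 p.2)%:E)%E.
Proof. by rewrite lee_fin cone_dist2_ge0. Qed.

Lemma HK_cost_ge0 alpha : (0 <= HK_cost d alpha)%E.
Proof. by apply: integral_ge0 => p _; exact: cost_ge0. Qed.

Lemma continuous_pair_at (T T1 T2 : topologicalType) (f : T -> T1) (g : T -> T2) x :
  {for x, continuous f} -> {for x, continuous g} ->
  {for x, continuous (fun x => (f x, g x))}.
Proof. by move=> cf cg; apply: cvg_pair; [exact: cf|exact: cg]. Qed.

Lemma continuous_pair (T T1 T2 : topologicalType) (f : T -> T1) (g : T -> T2) :
  continuous f -> continuous g -> continuous (fun x => (f x, g x)).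
Proof. by move=> cf cg x; apply: continuous_pair_at; [exact: cf|exact: cg]. Qed.

Lemma continuous_pt (r : R) : continuous (fun x : X => pt x r).
Proof.
move=> x; apply: (@continuous_comp _ _ _ (fun x => (x, r)) (fun q : X * R => pt q.1 q.2)).
  by apply: continuous_pair => // ?; [exact: cvg_id|exact: cvg_cst].
exact: continuous_cone_pt.
Qed.

Lemma hom_value_pt (g : X -> \bar R) x (r : R) :
  ((cone_radius (pt x r) ^+ 2)%:E * g (cone_base xbar (pt x r)) =
   (r ^+ 2)%:E * g x)%E.
Proof.
rewrite cone_radius_pt /= real_normK ?num_real//.
have [->|r0] := eqVneq r 0; first by rewrite expr0n !mul0e.
by rewrite cone_base_pt//= normr_gt0.
Qed.

(** The image of mu under x |-> ([x, 1], [x, 1]). *)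
Lemma diagonal_plan (mu : radon_measure R X) : exists alpha : radon_measure R CC,
  [/\ has_marginal fst alpha mu, has_marginal snd alpha mu & HK_cost d alpha = 0%E].
Proof.
have [alpha alphaE] := radon_image hT mu hCC
  (continuous_pair (@continuous_pt 1) (@continuous_pt 1)).
exists alpha; split.
- move=> g mg g0; rewrite alphaE.
  + by apply: eq_integral => x _; rewrite /hom_integrand hom_value_pt expr1n mul1e.
  + by apply: measurable_hom_integrand => //; exact: continuous_fst.
  + by move=> p; exact: hom_integrand_ge0.
- move=> g mg g0; rewrite alphaE.
  + by apply: eq_integral => x _; rewrite /hom_integrand hom_value_pt expr1n mul1e.
  + by apply: measurable_hom_integrand => //; exact: continuous_snd.
  + by move=> p; exact: hom_integrand_ge0.
- rewrite /HK_cost alphaE; [|exact: measurable_cost|exact: cost_ge0].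
  by apply: integral0_eq => x _ /=; rewrite (cone_dist2_refl dX).
Qed.

Lemma swapped_plan (mu1 mu2 : radon_measure R X) (alpha : radon_measure R CC) :
  has_marginal fst alpha mu1 -> has_marginal snd alpha mu2 ->
  exists beta : radon_measure R CC,
  [/\ has_marginal fst beta mu2, has_marginal snd beta mu1 &
      HK_cost d beta = HK_cost d alpha].
Proof.
move=> h1 h2; have [beta betaE] := radon_image hCC alpha hCC
  (continuous_pair (@continuous_snd C C) (@continuous_fst C C)).
exists beta; split.
- move=> g mg g0; rewrite betaE ?h2//.
  + by apply: measurable_hom_integrand => //; exact: continuous_fst.
  + by move=> p; exact: hom_integrand_ge0.
- move=> g mg g0; rewrite betaE ?h1//.
  + by apply: measurable_hom_integrand => //; exact: continuous_snd.
  + by move=> p; exact: hom_integrand_ge0.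
- rewrite /HK_cost betaE; [|exact: measurable_cost|exact: cost_ge0].
  by apply: eq_integral => p _ /=; rewrite (cone_dist2_sym dX).
Qed.

(** Send mu1 to the vertex, by x |-> ([x, 1], [x, 0]), and create mu2 from it, by
    x |-> ([x, 0], [x, 1]).  The cost is the total mass of mu1 and mu2. *)
Lemma destroy_create_plan (mu1 mu2 : radon_measure R X) :
  exists alpha : radon_measure R CC,
  [/\ has_marginal fst alpha mu1, has_marginal snd alpha mu2 &
      (HK_cost d alpha < +oo)%E].
Proof.
have [a1 a1E] := radon_image hT mu1 hCC
  (continuous_pair (@continuous_pt 1) (@continuous_pt 0)).
have [a2 a2E] := radon_image hT mu2 hCC
  (continuous_pair (@continuous_pt 0) (@continuous_pt 1)).
have [alpha alphaE] := radon_add hCC a1 a2.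
have int0 (nu : radon_measure R X) (g : X -> \bar R) :
    (\int[nu]_x ((0 ^+ 2)%:E * g x) = 0)%E.
  by apply: integral0_eq => x _; rewrite expr0n mul0e.
have int1 (nu : radon_measure R X) (g : X -> \bar R) :
    (\int[nu]_x ((1 ^+ 2)%:E * g x) = \int[nu]_x g x)%E.
  by apply: eq_integral => x _; rewrite expr1n mul1e.
exists alpha; split.
- move=> g mg g0.
  have mh := measurable_hom_integrand xbar (@continuous_fst C C) mg.
  have h0 p := hom_integrand_ge0 xbar fst p g0.
  rewrite alphaE// a1E// a2E//.
  under [X in (_ = X + _)%E]eq_integral do rewrite /hom_integrand hom_value_pt.
  under [X in (_ = _ + X)%E]eq_integral do rewrite /hom_integrand hom_value_pt.
  by rewrite int1 int0 adde0.
- move=> g mg g0.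
  have mh := measurable_hom_integrand xbar (@continuous_snd C C) mg.
  have h0 p := hom_integrand_ge0 xbar snd p g0.
  rewrite alphaE// a1E// a2E//.
  under [X in (_ = X + _)%E]eq_integral do rewrite /hom_integrand hom_value_pt.
  under [X in (_ = _ + X)%E]eq_integral do rewrite /hom_integrand hom_value_pt.
  by rewrite int1 int0 add0e.
- rewrite /HK_cost alphaE; [|exact: measurable_cost|exact: cost_ge0].
  rewrite a1E; [|exact: measurable_cost|exact: cost_ge0].
  rewrite a2E; [|exact: measurable_cost|exact: cost_ge0].
  apply: lte_add_pinfty.
    rewrite (_ : integral _ _ _ = \int[mu1]_x 1%:E)%E.
      exact: radon_integral_cst_fin.
    apply: eq_integral => x _ /=; rewrite cone_dist2_vertex.
      by rewrite cone_radius_pt /= normr1 expr1n.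
    by rewrite cone_radius_pt /= normr0.
  rewrite (_ : integral _ _ _ = \int[mu2]_x 1%:E)%E.
    exact: radon_integral_cst_fin.
  apply: eq_integral => x _ /=; rewrite (cone_dist2_sym dX)// cone_dist2_vertex.
    by rewrite cone_radius_pt /= normr1 expr1n.
  by rewrite cone_radius_pt /= normr0.
Qed.

End elementary_plans.

(** * Normalization of a plan *)

Lemma integral_support d (T : measurableType d) (R : realType)
    (mu : {measure set T -> \bar R}) (D : set T) (f : T -> \bar R) :
  (forall x, ~ D x -> f x = 0%E) -> (\int[mu]_(x in D) f x = \int[mu]_x f x)%E.
Proof.
move=> f0; rewrite integral_mkcond; apply: eq_integral => x _.
by rewrite patchE; case: ifPn => //; rewrite notin_setE => /f0.
Qed.

Section normalization.
Context {R : realType} {X : ptopologicalType}.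
Variables (d : X -> X -> \bar R) (xbar : X).
Hypothesis hX : is_extended_metric_topological d.
Local Notation C := (cone R X).
Local Notation CC := (cone R X * cone R X)%type.
Local Notation CX := (cone R X * X)%type.
Local Notation pt x r := (cone_pt x (NngNum (normr_ge0 r)) : C).
Local Notation has_marginal := (has_marginal xbar).

Let hT : hausdorff_space X. Proof. exact: emt_hausdorff hX. Qed.
Let dX : is_extended_distance eq d. Proof. exact: emt_distance hX. Qed.
Let hCC : hausdorff_space CC. Proof. exact: hausdorff_coneX. Qed.
Let hCX : hausdorff_space CX. Proof. by apply: hausdorff_prod => //; exact: hausdorff_cone. Qed.

Definition cone_scale (c : C) (s : R) : C := pt (cone_base xbar c) (cone_radius c / s).

Lemma cone_radius_scale c s : 0 <= s -> cone_radius (cone_scale c s) = cone_radius c / s.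
Proof.
by move=> s0; rewrite cone_radius_pt /= ger0_norm// divr_ge0// cone_radius_ge0.
Qed.

Lemma hom_value_scale (g : X -> \bar R) c s : 0 < s ->
  ((s ^+ 2)%:E * ((cone_radius (cone_scale c s) ^+ 2)%:E *
     g (cone_base xbar (cone_scale c s))) =
   (cone_radius c ^+ 2)%:E * g (cone_base xbar c))%E.
Proof.
move=> s0; rewrite hom_value_pt muleA -EFinM; congr (_%:E * _)%E.
by rewrite -exprMn mulrCA divff ?mulr1// lt0r_neq0.
Qed.

Lemma cone_radius_pt1 x : cone_radius (pt x 1) = 1.
Proof. by rewrite cone_radius_pt /= normr1. Qed.

Lemma cone_base_pt1 x : cone_base xbar (pt x 1) = x.
Proof. by rewrite cone_base_pt //= normr1. Qed.

Lemma cone_dist2_scale c c' : 0 < cone_radius c' ->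
  cone_radius c' ^+ 2 *
    cone_dist2 d (cone_scale c (cone_radius c')) (pt (cone_base xbar c') 1) =
  cone_dist2 d c c'.
Proof.
move=> r0; rewrite !(cone_dist2E _ xbar) cone_radius_scale ?ltW//.
rewrite cone_radius_pt1 cone_base_pt1.
have [c0|c0] := ltP 0 (cone_radius c); last first.
  by rewrite (cone_radius_le0 c0) !(mul0r, mulr0, expr0n, add0r, subr0, expr1n, mulr1)/=.
rewrite /cone_scale cone_base_pt /= ?normr_gt0 ?mulf_neq0 ?invr_eq0 ?lt0r_neq0//.
by field; exact: lt0r_neq0.
Qed.

(** At the vertex the base point of u jumps, but there only the radius of the
    scaled point has to tend to 0. *)
Lemma continuous_cone_scale (T : topologicalType) (u v : T -> C) (p : T) :
  continuous u -> continuous v -> 0 < cone_radius (v p) ->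
  {for p, continuous (fun q => cone_scale (u q) (cone_radius (v q)))}.
Proof.
move=> cu cv v0.
have cru : cone_radius (u q) @[q --> p] --> cone_radius (u p).
  by apply: continuous_comp; [exact: cu|exact: continuous_cone_radius].
have crv : cone_radius (v q) @[q --> p] --> cone_radius (v p).
  by apply: continuous_comp; [exact: cv|exact: continuous_cone_radius].
have cq : cone_radius (u q) / cone_radius (v q) @[q --> p] -->
    cone_radius (u p) / cone_radius (v p).
  by apply: cvgM => //; apply: cvgV => //; exact: lt0r_neq0.
have [u0|u0] := ltP 0 (cone_radius (u p)).
  apply: (@continuous_comp _ _ _
    (fun q => (cone_base xbar (u q), cone_radius (u q) / cone_radius (v q)))
    (fun q : X * R => pt q.1 q.2)); last exact: continuous_cone_pt.
  apply: continuous_pair_at; last exact: cq.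
  apply: (@continuous_comp _ _ _ u (cone_base xbar)); first exact: cu.
  exact: continuous_cone_base.
move=> A; rewrite nbhs_cone_vertex; last first.
  by rewrite cone_radius_scale ?cone_radius_ge0// (cone_radius_le0 u0) mul0r.
move=> [e e0 eA]; apply: filterS (eA) _.
have /cvgrPdist_lt/(_ e e0) := cq.
rewrite (cone_radius_le0 u0) mul0r; apply: filterS => q /=.
rewrite sub0r normrN => h; rewrite cone_radius_scale ?cone_radius_ge0//.
exact: le_lt_trans (ler_norm _) h.
Qed.

(* pr' is the component normalized to radius 1; the first plan of a chain is
   normalized on its second component, the second plan on its first *)
Variables (pr pr' : CC -> C).
Hypothesis cpr : continuous pr.
Hypothesis cpr' : continuous pr'.
Variables (alpha : radon_measure R CC) (mu' : radon_measure R X).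
Hypothesis marg' : has_marginal pr' alpha mu'.

Let D : set CC := [set p | 0 < cone_radius (pr' p)].

Let oD : open D.
Proof.
have h : {in pr' @^-1` [set c : C | 0 < cone_radius c], continuous pr'}.
  by move=> p _; exact: cpr'.
exact: (open_comp h open_cone_pos).
Qed.

Lemma normalize : exists beta : radon_measure R CX,
  forall g : borel CX -> \bar R, measurable_fun setT g ->
    (forall y, (0 <= g y)%E) ->
  (\int[beta]_q g q = \int[alpha]_(p in D) ((cone_radius (pr' p) ^+ 2)%:E *
     g (cone_scale (pr p) (cone_radius (pr' p)), cone_base xbar (pr' p))))%E.
Proof.
apply: (@radon_push R CC CX hCC hCX alpha D (fun p => cone_radius (pr' p) ^+ 2)
  (fun p => (cone_scale (pr p) (cone_radius (pr' p)), cone_base xbar (pr' p)))).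
- exact: (open_borel oD).
- by move=> x _; exact: sqr_ge0.
- by apply/measurable_funTS/measurable_funX; exact: measurable_radius.
- apply: (@le_lt_trans _ _ (\int[alpha]_p (cone_radius (pr' p) ^+ 2)%:E)%E).
    apply: ge0_subset_integral => //; first exact: (open_borel oD).
      by apply/measurable_EFinP/measurable_funX; exact: measurable_radius.
    by move=> p _; rewrite lee_fin sqr_ge0.
  by rewrite (marginal_mass marg') -ge0_fin_numE// fin_num_measure.
- apply: in_continuous_within => p; rewrite inE => Dp.
  apply: (@continuous_pair_at _ _ _
    (fun p => cone_scale (pr p) (cone_radius (pr' p)))
    (fun p => cone_base xbar (pr' p))); first exact: continuous_cone_scale.
  apply: (@continuous_comp _ _ _ pr' (cone_base xbar)); first exact: cpr'.
  exact: continuous_cone_base.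
Qed.

Variable beta : radon_measure R CX.
Hypothesis betaE : forall g : borel CX -> \bar R, measurable_fun setT g ->
    (forall y, (0 <= g y)%E) ->
  (\int[beta]_q g q = \int[alpha]_(p in D) ((cone_radius (pr' p) ^+ 2)%:E *
     g (cone_scale (pr p) (cone_radius (pr' p)), cone_base xbar (pr' p))))%E.

Lemma normalize_marginal (B : set (borel X)) : measurable B ->
  beta (snd @^-1` B) = mu' B.
Proof.
move=> mB.
have mI : measurable_fun setT (fun x : borel X => (\1_B x)%:E : \bar R).
  by apply/measurable_EFinP; exact: measurable_indic.
have I0 (x : borel X) : (0 <= (\1_B x)%:E :> \bar R)%E by rewrite lee_fin.
have msB : measurable (snd @^-1` B : set (borel CX)).
  rewrite -[X in measurable X]setTI.
  exact: (continuous_borel (@continuous_snd C X)).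
have := marg' mI I0; rewrite integral_indic// setIT => ->.
have mJ : measurable_fun setT (fun q : borel CX => (\1_(snd @^-1` B) q)%:E : \bar R).
  by apply/measurable_EFinP; exact: measurable_indic.
have J0 (q : borel CX) : (0 <= (\1_(snd @^-1` B) q)%:E :> \bar R)%E by rewrite lee_fin.
have := betaE mJ J0; rewrite integral_indic// setIT => ->.
apply: integral_support => p /negP; rewrite -leNgt => r0.
by rewrite (cone_radius_le0 r0) expr0n mul0e.
Qed.

Lemma normalize_hom (g : borel X -> \bar R) : measurable_fun setT g ->
  (forall x, (0 <= g x)%E) ->
  (\int[beta]_q ((cone_radius q.1 ^+ 2)%:E * g (cone_base xbar q.1)) =
   \int[alpha]_(p in D) hom_integrand xbar pr g p)%E.
Proof.
move=> mg g0; rewrite betaE.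
- by apply: eq_integral => p; rewrite inE => Dp; rewrite hom_value_scale.
- have cf := @continuous_fst C X; apply: emeasurable_funM.
    by apply/measurable_EFinP/measurable_funX; exact: measurable_radius.
  exact: (measurableT_comp mg (measurable_base xbar cf)).
- by move=> q; rewrite mule_ge0// lee_fin sqr_ge0.
Qed.

Lemma continuous_pt1 : continuous (fun q : CX => (q.1, pt q.2 1)).
Proof.
apply: continuous_pair; first exact: continuous_fst.
move=> q; apply: (@continuous_comp _ _ _ snd (fun x => pt x 1) q).
  exact: continuous_snd.
exact: continuous_pt.
Qed.

Lemma measurable_cost_pt1 : measurable_fun setT
  ((fun q => (cone_dist2 d q.1 (pt q.2 1))%:E) : borel CX -> \bar R).
Proof.
exact: (measurableT_comp (measurable_cost hX) (continuous_borel continuous_pt1)).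
Qed.

Lemma normalize_cost :
  (\int[beta]_q (cone_dist2 d q.1 (pt q.2 1))%:E =
   \int[alpha]_(p in D) (cone_dist2 d (pr p) (pr' p))%:E)%E.
Proof.
rewrite betaE; last 2 first.
- exact: measurable_cost_pt1.
- by move=> q; rewrite lee_fin cone_dist2_ge0.
by apply: eq_integral => p; rewrite inE => Dp /=; rewrite -EFinM cone_dist2_scale.
Qed.

End normalization.

Section normalized_measure.
Context {R : realType} {X : ptopologicalType}.
Variables (d : X -> X -> \bar R) (xbar : X).
Hypothesis hX : is_extended_metric_topological d.
Local Notation CC := (cone R X * cone R X)%type.

(** Dividing both radii by that of pr' and multiplying the measure by its square
    preserves marginals and cost, which are homogeneous of degree two.  Once
    this radius is 1, the homogeneous marginal mu' is an ordinary image measure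
    on X, and the second cone point can be replaced by its base point. *)
Lemma normalized_measure (pr pr' : CC -> cone R X) (alpha : radon_measure R CC)
    (mu' : radon_measure R X) : continuous pr -> continuous pr' ->
  has_marginal xbar pr' alpha mu' ->
  exists beta : radon_measure R (cone R X * X)%type,
  [/\ forall B : set (borel X), measurable B -> beta (snd @^-1` B) = mu' B,
      forall g : borel X -> \bar R, measurable_fun setT g ->
        (forall x, (0 <= g x)%E) ->
        (\int[beta]_q ((cone_radius q.1 ^+ 2)%:E * g (cone_base xbar q.1)) =
         \int[alpha]_(p in [set p | (0 < cone_radius (pr' p))%R])
           hom_integrand xbar pr g p)%E &
      (\int[beta]_q (cone_dist2 d q.1 (cone_pt q.2 (NngNum (normr_ge0 1))))%:E =
       \int[alpha]_(p in [set p | (0 < cone_radius (pr' p))%R])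
         (cone_dist2 d (pr p) (pr' p))%:E)%E].
Proof.
move=> cpr cpr' h; have [beta betaE] := normalize hX cpr cpr' h.
exists beta; split.
- exact: (normalize_marginal h betaE).
- exact: (normalize_hom betaE).
- exact: (normalize_cost hX betaE).
Qed.

End normalized_measure.

(** * Gluing plans *)

Lemma ge0_integral_setC d (T : measurableType d) (R : realType)
    (mu : {measure set T -> \bar R}) (D : set T) (f : T -> \bar R) :
  measurable D -> measurable_fun setT f -> (forall x, (0 <= f x)%E) ->
  (\int[mu]_x f x = \int[mu]_(x in D) f x + \int[mu]_(x in ~` D) f x)%E.
Proof.
move=> mD mf f0; rewrite -ge0_integral_setU//.
- by rewrite setUv.
- exact: measurableC.
- by rewrite setUv.
- by rewrite disj_set2E setICr.
Qed.

Section gluing_plans.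
Context {R : realType} {X : ptopologicalType}.
Variables (d : X -> X -> \bar R) (xbar : X).
Hypothesis hX : is_extended_metric_topological d.
Local Notation C := (cone R X).
Local Notation CC := (cone R X * cone R X)%type.
Local Notation CX := (cone R X * X)%type.
Local Notation pt x r := (cone_pt x (NngNum (normr_ge0 r)) : C).
Local Notation has_marginal := (has_marginal xbar).

Let hT : hausdorff_space X. Proof. exact: emt_hausdorff hX. Qed.
Let dX : is_extended_distance eq d. Proof. exact: emt_distance hX. Qed.
Let hCC : hausdorff_space CC. Proof. exact: hausdorff_coneX. Qed.
Let hCX : hausdorff_space CX.
Proof. by apply: hausdorff_prod => //; exact: hausdorff_cone. Qed.

Let cf : continuous (@fst C C). Proof. exact: continuous_fst. Qed.
Let cs : continuous (@snd C C). Proof. exact: continuous_snd. Qed.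

Let mpos (pr : CC -> C) : continuous pr ->
  measurable ([set p | 0 < cone_radius (pr p)] : set (borel CC)).
Proof.
move=> cpr; apply: open_borel.
have h : {in pr @^-1` [set c : C | 0 < cone_radius c], continuous pr}.
  by move=> p _; exact: cpr.
exact: (open_comp h open_cone_pos).
Qed.

Variables (mu1 mu2 mu3 : radon_measure R X) (alpha beta : radon_measure R CC).
Hypothesis alpha1 : has_marginal fst alpha mu1.
Hypothesis alpha2 : has_marginal snd alpha mu2.
Hypothesis beta2 : has_marginal fst beta mu2.
Hypothesis beta3 : has_marginal snd beta mu3.

(** The plan has three parts: the image of the gluing of the normalized plans
    under forgetting the middle point, alpha restricted to r2 = 0 and beta
    restricted to r2 = 0.  On the leftover parts the middle point is the
    vertex; there alpha adds no mass to mu3 and beta none to mu1, while they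
    complete the other marginals. *)
Lemma glued_plan (eta : R) : 0 < eta -> exists rho : radon_measure R CC,
  [/\ has_marginal fst rho mu1, has_marginal snd rho mu3 &
    (HK_cost d rho <= (1 + eta)%:E * HK_cost d alpha +
       (1 + eta^-1)%:E * HK_cost d beta)%E].
Proof.
move=> eta0.
(* a and b are the plans normalized in the middle, and g glues them *)
have [a [aM aH aC]] := normalized_measure hX cf cs alpha2.
have [b [bM bH bC]] := normalized_measure hX cs cf beta2.
have csX := @continuous_snd C X; have cfX := @continuous_fst C X.
have cfW := @continuous_fst CX CX; have csW := @continuous_snd CX CX.
have [g [gA gB g0]] := glue hCX hCX hT csX csX
  (fun B mB => etrans (aM B mB) (esym (bM B mB))).
have gEA := integral_of_image cfW gA; have gEB := integral_of_image csW gB.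
have cW : continuous (fun p : CX * CX => (p.1.1, p.2.1)).
  by apply: continuous_pair => p; apply: continuous_comp;
    [exact: cfW|exact: cfX|exact: csW|exact: cfX].
have hW : hausdorff_space (CX * CX)%type by exact: hausdorff_prod.
have [g' g'E] := radon_image hW g hCC cW.
have [a0 a0E] := radon_restriction hCC alpha (measurableC (mpos cs)).
have [b0 b0E] := radon_restriction hCC beta (measurableC (mpos cf)).
have [s sE] := radon_add hCC g' a0; have [rho rhoE] := radon_add hCC s b0.
have mradius (pr : CX -> C) : continuous pr ->
    measurable_fun setT ((fun q => (cone_radius (pr q) ^+ 2)%:E) : borel CX -> \bar R).
  by move=> cpr; apply/measurable_EFinP/measurable_funX; exact: measurable_radius.
have mG (h : borel X -> \bar R) : measurable_fun setT h -> measurable_fun setT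
    ((fun q => (cone_radius q.1 ^+ 2)%:E * h (cone_base xbar q.1)) : borel CX -> \bar R)%E.
  move=> mh; apply: emeasurable_funM; first exact: (mradius fst).
  exact: (measurableT_comp mh (measurable_base xbar cfX)).
have G0 (h : X -> \bar R) (q : CX) : (forall x, 0 <= h x)%E ->
    (0 <= (cone_radius q.1 ^+ 2)%:E * h (cone_base xbar q.1))%E.
  by move=> h0; rewrite mule_ge0// lee_fin sqr_ge0.
exists rho; split.
- move=> h mh h0.
  have mH := measurable_hom_integrand xbar cf mh.
  have H0 p := hom_integrand_ge0 xbar fst p h0.
  rewrite rhoE// sE// g'E// a0E// b0E//.
  rewrite -[X in (X + _ + _)%E](gEA _ (mG h mh) (fun q => G0 h q h0)) aH//.
  rewrite -ge0_integral_setC//; last exact: mpos.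
  rewrite [X in (_ = _ + X)%E]integral0_eq ?adde0; first exact: alpha1.
  move=> p /negP; rewrite -leNgt => r0.
  by rewrite /hom_integrand (cone_radius_le0 r0) expr0n mul0e.
- move=> h mh h0.
  have mH := measurable_hom_integrand xbar cs mh.
  have H0 p := hom_integrand_ge0 xbar snd p h0.
  rewrite rhoE// sE// g'E// a0E// b0E//.
  rewrite -[X in (X + _ + _)%E](gEB _ (mG h mh) (fun q => G0 h q h0)) bH//.
  rewrite [X in (_ = _ + X + _)%E]integral0_eq ?adde0; last first.
    move=> p /negP; rewrite -leNgt => r0.
    by rewrite /hom_integrand (cone_radius_le0 r0) expr0n mul0e.
  by rewrite -ge0_integral_setC//; [exact: beta3|exact: mpos].
have mc := measurable_cost hX; have c0 := @cost_ge0 R X d.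
rewrite /HK_cost rhoE// sE// g'E// a0E// b0E//.
have mk := measurable_cost_pt1 hX.
have k0 (q : CX) : (0 <= (cone_dist2 d q.1 (pt q.2 1))%:E)%E.
  by rewrite lee_fin cone_dist2_ge0.
have e0 : 0 <= 1 + eta by rewrite addr_ge0// ltW.
have e'0 : 0 <= 1 + eta^-1 by rewrite addr_ge0// invr_ge0 ltW.
have mk1 := measurableT_comp mk (continuous_borel cfW).
have mk2 := measurableT_comp mk (continuous_borel csW).
have glued : (\int[g]_p (cone_dist2 d p.1.1 p.2.1)%:E <=
    (1 + eta)%:E * \int[alpha]_(p in [set p | (0 < cone_radius p.2)%R]) (cone_dist2 d p.1 p.2)%:E +
    (1 + eta^-1)%:E * \int[beta]_(p in [set p | (0 < cone_radius p.1)%R]) (cone_dist2 d p.1 p.2)%:E)%E.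
  rewrite -aC.
  have -> : (\int[beta]_(p in [set p | (0 < cone_radius p.1)%R]) (cone_dist2 d p.1 p.2)%:E =
      \int[b]_q (cone_dist2 d q.1 (pt q.2 1))%:E)%E.
    by rewrite bC; apply: eq_integral => p _; rewrite (cone_dist2_sym dX).
  rewrite (gEA _ mk k0) (gEB _ mk k0).
  rewrite -ge0_integralZl; [|by []|exact: mk1|by move=> p _; exact: k0|by rewrite lee_fin].
  rewrite -ge0_integralZl; [|by []|exact: mk2|by move=> p _; exact: k0|by rewrite lee_fin].
  rewrite -ge0_integralD//; last 4 first.
  - by move=> p _; rewrite mule_ge0.
  - exact: measurable_funeM.
  - by move=> p _; rewrite mule_ge0.
  - exact: measurable_funeM.
  apply: ae_ge0_le_integral => //.
  - by move=> p _; rewrite lee_fin cone_dist2_ge0.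
  - exact: (measurableT_comp mc (continuous_borel cW)).
  - by move=> p _; rewrite adde_ge0// mule_ge0.
  - by apply: emeasurable_funD; exact: measurable_funeM.
  case: g0 => N [mN N0 sub]; exists N; split => // p /= h; apply: sub => /= xy.
  apply: h => _.
  rewrite -!EFinM -EFinD lee_fin xy [X in _ <= _ + _ * X](cone_dist2_sym dX).
  exact: cone_dist2_triangle.
(* the leftover parts keep their own cost, and their coefficients 1 + eta and
   1 + eta^-1 are at least 1 *)
have AE := ge0_integral_setC alpha (mpos cs) mc c0.
have BE := ge0_integral_setC beta (mpos cf) mc c0.
rewrite AE BE.
set A := integral alpha [set p | _] _ in glued *.
set A' := integral alpha _ _.
set B := integral beta [set p | _] _ in glued *.
set B' := integral beta _ _.
have A'0 : (0 <= A')%E by apply: integral_ge0.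
have B'0 : (0 <= B')%E by apply: integral_ge0.
have A0 : (0 <= A)%E by apply: integral_ge0.
have B0 : (0 <= B)%E by apply: integral_ge0.
rewrite -addeA (ge0_muleDr _ A0 A'0) (ge0_muleDr _ B0 B'0) [leRHS]addeACA.
apply: leeD => //; apply: leeD.
  by apply: (lee_pemull A'0); rewrite lee_fin lerDl ltW.
by apply: (lee_pemull B'0); rewrite lee_fin lerDl invr_ge0 ltW.
Qed.

End gluing_plans.

(** * Nondegeneracy *)

Section separation.
Context {R : realType} {X : ptopologicalType}.
Variables (d : X -> X -> \bar R) (xbar : X).
Hypothesis hX : is_extended_metric_topological d.
Local Notation C := (cone R X).
Local Notation CC := (cone R X * cone R X)%type.
Local Notation has_marginal := (has_marginal xbar).
Local Notation angle c1 c2 :=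
  (truncated_angle d (cone_base xbar c1) (cone_base xbar c2)).

Let hT : hausdorff_space X. Proof. exact: emt_hausdorff hX. Qed.
Let dX : is_extended_distance eq d. Proof. exact: emt_distance hX. Qed.

(** A lower semicontinuous function that is positive at each point of the compact
    set K `*` K' is bounded below there by a positive constant. *)
Lemma compact_dist_gt0 (K K' : set X) : compact K -> compact K' ->
  K `&` K' = set0 ->
  exists2 delta : R, 0 < delta &
    forall x y, K x -> K' y -> (delta%:E < d x y)%E.
Proof.
move=> cK cK' KK'.
have /compact_near_coveringP cover := compact_setX cK cK'.
have /cover h : forall p, (K `*` K') p ->
    \forall q \near p & delta \near (0 : R)^'+, (delta%:E < d q.1 q.2)%E.
  move=> [x y] [/= Kx K'y].
  have dxy : (0 < d x y)%E.
    rewrite lt_neqAle (Defs.edist_ge0 dX) andbT; apply/eqP => /esym/(Defs.edist_eq0 dX) xy.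
    by rewrite -xy in K'y; have : (K `&` K') x by []; rewrite KK'.
  have [a a0 ad] : exists2 a : R, 0 < a & (a%:E < d x y)%E.
    case: (d x y) dxy => [r| |]//.
    - rewrite lte_fin => r0; exists (r / 2); first by rewrite divr_gt0.
      by rewrite lte_fin ltr_pdivrMr// ltr_pMr// ltr1n.
    - by move=> _; exists 1; rewrite ?ltry.
  have [V nV VP] := emt_lsc hX (ad : (a%:E < d (x, y).1 (x, y).2)%E).
  exists (V, [set e | e < a]) => /=; first by split=> //; exact: nbhs_right_lt.
  by move=> [q e] [/= Vq ea]; apply: lt_trans (VP _ Vq); rewrite lte_fin.
have /filter_ex[delta [d0 dP]] :
    \forall delta \near (0 : R)^'+, 0 < delta /\
      (K `*` K') `<=` (fun p => (delta%:E < d p.1 p.2)%E).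
  by near=> delta; split; [near: delta; exact: nbhs_right_gt|near: delta; exact: h].
by exists delta => // x y Kx K'y; apply: (dP (x, y)).
Unshelve. all: by end_near. Qed.

(** Follow the mass r1^2 that a plan takes from K.  Landing in K, it is at most
    (1 + eta) r2^2 up to a multiple of the cost, and landing outside K and K'
    it is at most 2 r2^2 up to such a multiple.  Landing in K', it turns by an
    angle bounded below, and r1^2 itself is at most a multiple of the cost.
    The constant M does not depend on the plan, which matters when a sequence
    of plans of vanishing cost is considered. *)
Lemma mass_le (K K' : set X) (eta : R) : compact K -> compact K' ->
  K `&` K' = set0 -> 0 < eta ->
  exists2 M : R, 0 <= M & forall (alpha : radon_measure R CC) mu nu,
    has_marginal fst alpha mu -> has_marginal snd alpha nu ->
    (mu K <= (1 + eta)%:E * nu K + 2%:E * nu (~` (K `|` K')) +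
       M%:E * HK_cost d alpha)%E.
Proof.
move=> cK cK' KK' eta0; have [delta delta0 dP] := compact_dist_gt0 cK cK' KK'.
(* the angle is truncated at pi, so delta is capped by 1 < pi *)
pose m : R := Num.min delta 1.
have m0 : 0 < m by rewrite lt_min delta0 ltr01.
have mpi : m <= pi by rewrite (le_trans _ (pi_ge2 R))// ge_min ler1n orbT.
pose k := cos m.
have k1 : k < 1.
  by rewrite -(@cos0 R) ltr_cos// in_itv/= ?lexx ?pi_ge0// mpi ltW.
have kN1 : -1 < k.
  rewrite -(@cospi R) ltr_cos ?in_itv/= ?lexx ?pi_ge0 ?(ltW m0)//.
  by rewrite (@le_lt_trans _ _ 1) ?ge_min ?lexx ?orbT// (lt_le_trans _ (pi_ge2 R))// ltr1n.
have k20 : 0 < 1 - k ^+ 2 by nra.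
have angleK (c1 c2 : C) : K (cone_base xbar c1) -> K' (cone_base xbar c2) ->
    cos (angle c1 c2) <= k.
  move=> h1 h2; have /andP[a0 api] := truncated_angle_bounds dX (cone_base xbar c1) (cone_base xbar c2).
  rewrite leNgt ltr_cos ?in_itv/= ?a0 ?mpi ?(ltW m0)// -leNgt.
  rewrite -lee_fin fineK.
    rewrite le_min lee_fin mpi andbT ltW// (le_lt_trans _ (dP _ _ h1 h2))//.
    by rewrite lee_fin ge_min lexx.
  rewrite ge0_fin_numE; first by rewrite gt_min ltry orbT.
  by rewrite le_min (Defs.edist_ge0 dX) lee_fin pi_ge0.
(* the sum of the constants of the three cases *)
pose M := 2 + (1 + eta^-1) + (1 - k ^+ 2)^-1.
have ie0 : 0 < eta^-1 by rewrite invr_gt0.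
have ik0 : 0 < (1 - k ^+ 2)^-1 by rewrite invr_gt0.
have M0 : 0 <= M by rewrite /M; lra.
exists M => // alpha mu nu h1 h2.
pose Z := ~` (K `|` K').
have mK : measurable (K : set (borel X)) by exact: compact_borel.
have mZ : measurable (Z : set (borel X)).
  by apply: measurableC; apply: measurableU => //; exact: compact_borel.
have mI (A : set (borel X)) : measurable A ->
    measurable_fun setT (fun x : borel X => (\1_A x)%:E : \bar R).
  by move=> mA; apply/measurable_EFinP; exact: measurable_indic.
have I0 (A : set (borel X)) (x : borel X) : (0 <= (\1_A x)%:E :> \bar R)%E.
  by rewrite lee_fin.
have marg pr (l : radon_measure R X) (A : set (borel X)) :
    has_marginal pr alpha l -> measurable A ->
    (l A = \int[alpha]_p hom_integrand xbar pr (fun x => (\1_A x)%:E) p)%E.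
  by move=> h mA; rewrite -h ?integral_indic ?setIT//; exact: mI.
rewrite (marg _ _ _ h1 mK) (marg _ _ _ h2 mK) (marg _ _ _ h2 mZ) /HK_cost.
have cf := @continuous_fst C C; have cs := @continuous_snd C C.
have mc := measurable_cost hX.
have mH pr (A : set (borel X)) : continuous pr -> measurable A ->
    measurable_fun setT (hom_integrand xbar pr (fun x => (\1_A x)%:E) : borel CC -> \bar R).
  by move=> cpr mA; apply: measurable_hom_integrand => //; exact: mI.
have H0 pr (A : set (borel X)) (p : borel CC) :
    (0 <= hom_integrand xbar pr (fun x => (\1_A x)%:E) p :> \bar R)%E.
  by apply: hom_integrand_ge0 => x; exact: I0.
have Me : (0 <= 1 + eta) by rewrite addr_ge0// ltW.
rewrite -(ge0_integralZl_EFin _ _ _ (mH snd K cs mK) Me)//.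
rewrite -(ge0_integralZl_EFin _ _ _ (mH snd Z cs mZ) (ler0n _ 2))//.
rewrite -(ge0_integralZl_EFin _ _ _ mc M0)//; last by move=> p _; exact: cost_ge0.
have mHe (c : R) (A : set (borel X)) : measurable A -> measurable_fun setT
    ((fun p => c%:E * hom_integrand xbar snd (fun x => (\1_A x)%:E) p) : borel CC -> \bar R)%E.
  by move=> mA; apply: measurable_funeM; exact: mH.
have He0 (c : R) (A : set (borel X)) : 0 <= c -> forall p : CC,
    (0 <= c%:E * hom_integrand xbar snd (fun x => (\1_A x)%:E) p)%E.
  by move=> c0 p; rewrite mule_ge0.
have mcM := measurable_funeM M%:E mc.
have cM0 (p : CC) : (0 <= M%:E * (cone_dist2 d p.1 p.2)%:E)%E by rewrite mule_ge0// cost_ge0.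
rewrite -ge0_integralD; [|by []|by move=> p _; exact: (He0 _ _ Me)|exact: mHe
  |by move=> p _; exact: He0|exact: mHe].
rewrite -ge0_integralD; [|by []|by move=> p _; apply: adde_ge0; exact: He0
  |by apply: emeasurable_funD; exact: mHe|by move=> p _; exact: cM0|exact: mcM].
apply: ge0_le_integral; [by []|by move=> p _; exact: H0|exact: mH|by
  apply: emeasurable_funD; [apply: emeasurable_funD; exact: mHe|exact: mcM]|].
move=> [c1 c2] _; rewrite /hom_integrand /= -!EFinM -!EFinD lee_fin.
have D0 := @cone_dist2_ge0 R X d c1 c2.
have r20 : 0 <= cone_radius c2 ^+ 2 := sqr_ge0 _.
have r10 : 0 <= cone_radius c1 ^+ 2 := sqr_ge0 _.
have MD0 : 0 <= M * cone_dist2 d c1 c2 by exact: mulr_ge0.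
have [K1|K1] := boolP (cone_base xbar c1 \in K); rewrite !indicE ?K1 ?(negbTE K1); last first.
  rewrite mulr0; apply: addr_ge0 => //.
  by apply: addr_ge0; apply: mulr_ge0 => //; exact: mulr_ge0 r20 (ler0n _ _).
rewrite mulr1.
have hi : 0 <= (1 - k ^+ 2)^-1 * cone_dist2 d c1 c2 by exact: mulr_ge0 (ltW ik0) D0.
have he : 0 <= eta^-1 * cone_dist2 d c1 c2 by exact: mulr_ge0 (ltW ie0) D0.
have hZ : 0 <= cone_radius c2 ^+ 2 * (cone_base xbar c2 \in Z)%:R by exact: mulr_ge0 r20 (ler0n _ _).
have [K2|K2] := boolP (cone_base xbar c2 \in K).
  have := cone_radius_le_dist2 d c1 c2 eta0; rewrite mulr1 /M; lra.
have [K3|K3] := boolP (cone_base xbar c2 \in K').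
  have /(cone_dist2_ge_angle) := angleK c1 c2 (set_mem K1) (set_mem K3).
  by rewrite -ler_pdivlMl// => h; rewrite /M mulr0; lra.
have -> : cone_base xbar c2 \in Z.
  by rewrite in_setC in_setU negb_or K2.
have := cone_radius_le_dist2 d c1 c2 (ltr01 : 0 < 1 :> R).
by rewrite invr1 mulr1 mulr0 /M; lra.
Qed.

Definition HK_inf (mu nu : radon_measure R X) : \bar R :=
  ereal_inf (HK_cost d @` HK_admissible xbar mu nu).

Lemma HK_inf_ge0 mu nu : (0 <= HK_inf mu nu)%E.
Proof. by apply: le_ereal_inf_tmp => _ [alpha _ <-]; exact: HK_cost_ge0. Qed.

(** Choose K' first, so that little nu-mass is left outside K and K'; this fixes
    the constant of [mass_le], after which a plan of small enough cost is
    chosen. *)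
Lemma HK_inf0_compact mu nu (K : set X) : HK_inf mu nu = 0%E -> compact K ->
  (mu K <= nu K)%E.
Proof.
move=> I0 cK.
have mK : measurable (K : set (borel X)) by exact: compact_borel.
have fnu : nu K \is a fin_num by exact: fin_num_measure.
apply/lee_addgt0Pr => e e0.
have n0 : 0 <= fine (nu K) by rewrite fine_ge0.
(* the total error is eta * nu K + 2 eta + eta *)
pose eta := e / (fine (nu K) + 3).
have nu3 : 0 < fine (nu K) + 3 by lra.
have eta0 : 0 < eta by rewrite divr_gt0.
have [K' [cK' K'K K'e]] := radonP nu (measurableC mK) eta0.
have KK' : K `&` K' = set0 by rewrite -subset0 => x [Kx /K'K].
have [M M0 hM] := mass_le cK cK' KK' eta0.
have M1 : 0 < M + 1 by lra.
have : (HK_inf mu nu < (eta / (M + 1))%:E)%E by rewrite I0 lte_fin divr_gt0.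
move=> /ereal_inf_lt[_ [alpha /HK_admissibleP[h1 h2] <-] h].
apply: (le_trans (hM _ _ _ h1 h2)).
have mZ : (nu (~` (K `|` K')) <= eta%:E)%E.
  by rewrite setCU -setDE.
have hc : (M%:E * HK_cost d alpha <= eta%:E)%E.
  apply: (@le_trans _ _ (M%:E * (eta / (M + 1))%:E)%E).
    by apply: lee_wpmul2l; [rewrite lee_fin|exact: ltW].
  rewrite -EFinM lee_fin mulrCA ger_pMr// ler_pdivrMr// mul1r; lra.
apply: (@le_trans _ _ ((1 + eta)%:E * nu K + 2%:E * eta%:E + eta%:E)%E).
  by apply: leeD => //; apply: leeD => //; apply: lee_wpmul2l.
rewrite -(fineK fnu) -!EFinM -!EFinD lee_fin.
have -> : e = eta * (fine (nu K) + 3) by rewrite /eta divfK// lt0r_neq0.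
by lra.
Qed.

Lemma HK_inf0_le mu nu (B : set (borel X)) : HK_inf mu nu = 0%E ->
  measurable B -> (mu B <= nu B)%E.
Proof.
move=> I0 mB; apply/lee_addgt0Pr => e e0.
have [K [cK KB Ke]] := radonP mu mB e0.
have mK : measurable (K : set (borel X)) by exact: compact_borel.
have -> : mu B = (mu K + mu (B `\` K))%E.
  rewrite -measureU//; first by rewrite setDUK.
    exact: measurableD.
  by rewrite setDIK.
apply: leeD => //; apply: le_trans (HK_inf0_compact I0 cK) _.
by apply: le_measure; rewrite ?inE.
Qed.

End separation.

(** * The infimum of the cost *)

(** For s and t above the square roots of a and b, the choice eta = t / s turns
    (1 + eta) s^2 + (1 + eta^-1) t^2 into (s + t)^2.  Taking s and t slightly
    larger than the roots keeps them positive when a or b is zero. *)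
Lemma sqrtr_young (R : realType) (a b c : R) : 0 <= a -> 0 <= b ->
  (forall eta, 0 < eta -> c <= (1 + eta) * a + (1 + eta^-1) * b) ->
  Num.sqrt c <= Num.sqrt a + Num.sqrt b.
Proof.
move=> a0 b0 h; apply/ler_addgt0Pr => e e0.
pose s := Num.sqrt a + e / 2; pose t := Num.sqrt b + e / 2.
have sa := sqrtr_ge0 a; have sb := sqrtr_ge0 b.
have s0 : 0 < s by rewrite /s; lra.
have t0 : 0 < t by rewrite /t; lra.
have -> : Num.sqrt a + Num.sqrt b + e = s + t by rewrite /s /t; field.
have -> : s + t = Num.sqrt ((s + t) ^+ 2).
  by rewrite sqrtr_sqr ger0_norm// addr_ge0// ltW.
rewrite ler_wsqrtr//.
apply: (le_trans (h _ (divr_gt0 t0 s0))).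
have as2 : a <= s ^+ 2.
  by rewrite -{1}(sqr_sqrtr a0) lerXn2r ?nnegrE// ?ltW// /s; lra.
have bt2 : b <= t ^+ 2.
  by rewrite -{1}(sqr_sqrtr b0) lerXn2r ?nnegrE// ?ltW// /t; lra.
have -> : (s + t) ^+ 2 = (1 + t / s) * s ^+ 2 + (1 + (t / s)^-1) * t ^+ 2.
  by field; rewrite !lt0r_neq0.
by apply: lerD; apply: ler_wpM2l => //; rewrite addr_ge0 ?invr_ge0 ?divr_ge0 ?ltW.
Qed.

Section infimum.
Context {R : realType} {X : ptopologicalType}.
Variables (d : X -> X -> \bar R) (xbar : X).
Hypothesis hX : is_extended_metric_topological d.
Local Notation HK_inf := (HK_inf d xbar).

Lemma HK_inf_sym mu nu : HK_inf mu nu = HK_inf nu mu.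
Proof.
wlog suff le : mu nu / (HK_inf mu nu <= HK_inf nu mu)%E.
  by apply/eqP; rewrite eq_le !le.
apply: le_ereal_inf_tmp => _ [alpha /HK_admissibleP[h1 h2] <-].
have [beta [b1 b2 <-]] := swapped_plan hX h1 h2.
by apply: ereal_inf_lbound; exists beta => //; apply/HK_admissibleP.
Qed.

Lemma HK_inf_fin_num mu nu : HK_inf mu nu \is a fin_num.
Proof.
rewrite ge0_fin_numE ?HK_inf_ge0//.
have [alpha [h1 h2]] := destroy_create_plan xbar hX mu nu.
apply: le_lt_trans; apply: ereal_inf_lbound.
by exists alpha => //; apply/HK_admissibleP.
Qed.

Lemma HK_inf_eq0 mu nu : HK_inf mu nu = 0%E <-> eq_radon mu nu.
Proof.
split=> [I0 B mB|E].
  apply/eqP; rewrite eq_le (HK_inf0_le hX I0)//=.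
  have I0' : HK_inf nu mu = 0%E by rewrite HK_inf_sym.
  exact: (HK_inf0_le hX I0' mB).
have [alpha [h1 h2 c0]] := diagonal_plan xbar hX mu.
apply/eqP; rewrite eq_le HK_inf_ge0 andbT -c0.
apply: ereal_inf_lbound; exists alpha => //; apply/HK_admissibleP; split=> //.
have cs := @continuous_snd (cone R X) (cone R X).
apply/(has_marginalP _ _ _ cs) => B mB.
by rewrite -E//; move: B mB; apply/(has_marginalP _ _ _ cs).
Qed.

(** Glue nearly optimal plans; k is the gap to optimality for which the error is
    e once multiplied by (1 + eta) + (1 + eta^-1). *)
Lemma HK_inf_young mu1 mu2 mu3 (eta : R) : 0 < eta ->
  (HK_inf mu1 mu3 <=
     (1 + eta)%:E * HK_inf mu1 mu2 + (1 + eta^-1)%:E * HK_inf mu2 mu3)%E.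
Proof.
move=> eta0; have ie0 : 0 < eta^-1 by rewrite invr_gt0.
apply/lee_addgt0Pr => e e0.
pose k := e / (2 + eta + eta^-1).
have k0 : 0 < k by rewrite divr_gt0//; lra.
have [_ [alpha /HK_admissibleP[a1 a2] <-] alt] :=
  lb_ereal_inf_adherent k0 (HK_inf_fin_num mu1 mu2).
have [_ [beta /HK_admissibleP[b2 b3] <-] blt] :=
  lb_ereal_inf_adherent k0 (HK_inf_fin_num mu2 mu3).
have [rho [r1 r3 le]] := glued_plan hX a1 a2 b2 b3 eta0.
apply: (@le_trans _ _ (HK_cost d rho)).
  by apply: ereal_inf_lbound; exists rho => //; apply/HK_admissibleP.
apply: (le_trans le).
apply: (@le_trans _ _ ((1 + eta)%:E * (HK_inf mu1 mu2 + k%:E) +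
    (1 + eta^-1)%:E * (HK_inf mu2 mu3 + k%:E))%E).
  by apply: leeD; apply: lee_wpmul2l; rewrite ?lee_fin ?addr_ge0 ?ltW.
rewrite -(fineK (HK_inf_fin_num mu1 mu2)) -(fineK (HK_inf_fin_num mu2 mu3)).
set x := fine _; set y := fine _.
change (((1 + eta) * (x + k) + (1 + eta^-1) * (y + k))%:E <=
  ((1 + eta) * x + (1 + eta^-1) * y + e)%:E)%E; rewrite lee_fin.
have -> : e = k * (2 + eta + eta^-1) by rewrite divfK// gt_eqF//; lra.
by lra.
Qed.

Lemma HK_triangle mu1 mu2 mu3 :
  (HK d xbar mu1 mu3 <= HK d xbar mu1 mu2 + HK d xbar mu2 mu3)%E.
Proof.
have h (eta : R) := HK_inf_young mu1 mu2 mu3 (eta := eta).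
rewrite /HK -/(HK_inf mu1 mu3) -/(HK_inf mu1 mu2) -/(HK_inf mu2 mu3).
have n12 := HK_inf_ge0 d xbar mu1 mu2; have n23 := HK_inf_ge0 d xbar mu2 mu3.
move: n12 n23 h.
rewrite -(fineK (HK_inf_fin_num mu1 mu2)) -(fineK (HK_inf_fin_num mu2 mu3)).
rewrite -(fineK (HK_inf_fin_num mu1 mu3)) !lee_fin => n12 n23 h.
by apply: sqrtr_young => // eta /h.
Qed.

End infimum.

Theorem corollary7p14 (R : realType) (X : ptopologicalType)
    (d : X -> X -> \bar R) (xbar : X)
    (hX : is_extended_metric_topological d) :
  is_distance (@eq_radon R X) (HK d xbar) /\
  (forall mu1 mu2 mu3 : radon_measure R X,
    (HK d xbar mu1 mu3 <= HK d xbar mu1 mu2 + HK d xbar mu2 mu3)%E).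
Proof.
have tri := HK_triangle xbar hX; split=> //; split; last first.
  by move=> mu nu; rewrite sqrte_fin_num ?HK_inf_ge0//; exact: HK_inf_fin_num.
split=> //.
- by move=> mu nu; exact: sqrte_ge0.
- move=> mu nu; rewrite -(HK_inf_eq0 xbar hX); split=> h; last first.
    by rewrite /HK [ereal_inf _]h sqrte0.
  by rewrite -(sqr_sqrte (HK_inf_ge0 d xbar mu nu)) [sqrte _]h expe2 mule0.
- by move=> mu nu; rewrite /HK [ereal_inf _](HK_inf_sym xbar hX).
Qed.
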